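(* Consider the problem and the SONATA algorithm described below, with $\{G^k\}$ $B$-strongly connected, each $\mathbf{A}^k$ compliant with $G^k$ and column stochastic, and surrogates satisfying Assumption III.14. Let $\bar{\mathbf{x}}^k=\frac1I\sum_i\mathbf{x}_{(i)}^k$ and $M(\mathbf{x}^k)\triangleq\max\{J(\bar{\mathbf{x}}^k)^2,D(\mathbf{x}^k)^2\}$. Suppose either (a) $\gamma^k\in(0,1]$ with $\lim_k\gamma^k=0$ and $\sum_k\gamma^k=\infty$; or (b) $\gamma^k\equiv\gamma$ constant with $\gamma\in(0,\bar\gamma]$, where $\bar\gamma>0$ is a sufficiently small threshold depending only on the problem data, the network and the weights. Then $\lim_{k\to\infty}M(\mathbf{x}^k)=0$.
   Context: Problem: minimize $V(\mathbf{x})\triangleq F(\mathbf{x})+G(\mathbf{x})$, $F=\sum_{i=1}^If_i$, over $\mathbf{x}\in X$, where $X\subseteq\mathbb{R}^m$ is nonempty closed convex; each $f_i:O\to\mathbb{R}$ is $C^1$ on an open set $O\supseteq X$ with $\nabla f_i$ $L_i$-Lipschitz on $X$; $G:O\to\mathbb{R}$ is convex (possibly nonsmooth); $V$ is bounded below on $X$. Network: digraphs $G^k=(\{1,\dots,I\},E^k)$, $(j,i)\in E^k$ meaning $j$ can send to $i$; $B$-strongly connected: there is an integer $B>0$ with $\bigcup_{t=k}^{k+B-1}E^t$ strongly connected for every $k$. $\mathbf{A}^k=(a_{ij}^k)$ compliant with $G^k$: $a_{ij}^k=0$ if $j\ne i$ and $(j,i)\notin E^k$, $a_{ij}^k\ge\kappa$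 if $(j,i)\in E^k$, $a_{ii}^k\ge\kappa$ for some $\kappa>0$; column stochastic: nonnegative with $\mathbf{1}^T\mathbf{A}^k=\mathbf{1}^T$. Assumption III.14 on $\widetilde f_i:O\times O\to\mathbb{R}$: $\widetilde f_i(\cdot|\mathbf{x})$ is $\tau_i$-strongly convex on $X$ for all $\mathbf{x}\in X$; $\widetilde f_i(\cdot|\mathbf{x})$ is $C^1$ on $O$ with $\nabla\widetilde f_i(\mathbf{x}|\mathbf{x})=\nabla f_i(\mathbf{x})$ for $\mathbf{x}\in X$; $\nabla\widetilde f_i(\mathbf{x}|\cdot)$ is $\widetilde L_i$-Lipschitz on $X$ for all $\mathbf{x}\in X$. SONATA: initialize $\mathbf{x}_{(i)}^0\in X$, $\phi_{(i)}^0=1$, $\mathbf{y}_{(i)}^0=\nabla f_i(\mathbf{x}_{(i)}^0)$; at iteration $k$, each agent $i$ computes $\widetilde{\mathbf{x}}_i^k=\operatorname{argmin}_{\mathbf{x}\in X}\{\widetilde f_i(\mathbf{x}|\mathbf{x}_{(i)}^k)+(I\mathbf{y}_{(i)}^k-\nabla f_i(\mathbf{x}_{(i)}^k))^T(\mathbf{x}-\mathbf{x}_{(i)}^k)+G(\mathbf{x})\}$, $\mathbf{x}_{(i)}^{k+1/2}=\mathbf{x}_{(i)}^k+\gamma^k(\widetilde{\mathbf{x}}_i^k-\mathbf{x}_{(i)}^k)$, then $\phi_{(i)}^{k+1}=\sum_ja_{ij}^k\phi_{(j)}^k$, $\mathbf{x}_{(i)}^{k+1}=\frac{1}{\phi_{(i)}^{k+1}}\sum_ja_{ij}^k\phi_{(j)}^k\mathbf{x}_{(j)}^{k+1/2}$,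 $\mathbf{y}_{(i)}^{k+1}=\frac{1}{\phi_{(i)}^{k+1}}\sum_ja_{ij}^k\phi_{(j)}^k\mathbf{y}_{(j)}^k+\frac{1}{\phi_{(i)}^{k+1}}(\nabla f_i(\mathbf{x}_{(i)}^{k+1})-\nabla f_i(\mathbf{x}_{(i)}^k))$. Merit functions: $J(\bar{\mathbf{x}})\triangleq\big\|\bar{\mathbf{x}}-\operatorname{argmin}_{\mathbf{y}\in X}\{\nabla F(\bar{\mathbf{x}})^T(\mathbf{y}-\bar{\mathbf{x}})+\frac12\|\mathbf{y}-\bar{\mathbf{x}}\|^2+G(\mathbf{y})\}\big\|$ and $D(\mathbf{x}^k)\triangleq\|\mathbf{x}^k-\mathbf{1}_I\otimes\bar{\mathbf{x}}^k\|$, where $\mathbf{x}^k=(\mathbf{x}_{(i)}^k)_{i=1}^I$ stacked. *)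

(* Defs.v *)
From Stdlib Require Import Reals Relations ClassicalEpsilon.
Open Scope R_scope.

(* Vectors of R^m are represented as functions nat -> R whose coordinates
   j >= m vanish (predicate in_Vm m). *)
Definition vec := nat -> R.
Definition vzero : vec := fun _ => 0.
Definition vadd (x y : vec) : vec := fun j => x j + y j.
Definition vsub (x y : vec) : vec := fun j => x j - y j.
Definition vscal (c : R) (x : vec) : vec := fun j => c * x j.

Fixpoint rsum (n : nat) (f : nat -> R) : R :=
  match n with O => 0 | S n' => rsum n' f + f n' end.
Definition vsum (n : nat) (f : nat -> vec) : vec := fun j => rsum n (fun i => f i j).

Definition inner (m : nat) (x y : vec) : R := rsum m (fun j => x j * y j).
Definition norm (m : nat) (x : vec) : R := sqrt (inner m x x).
Definition in_Vm (m : nat) (x : vec) : Prop := forall j, (m <= j)%nat -> x j = 0.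

Definition comb (t : R) (x y : vec) : vec := vadd (vscal t x) (vscal (1 - t) y).

Definition is_open (m : nat) (O : vec -> Prop) : Prop :=
  forall x, O x -> exists eps, 0 < eps /\
    forall y, in_Vm m y -> norm m (vsub y x) < eps -> O y.
Definition is_closed (m : nat) (X : vec -> Prop) : Prop :=
  forall (u : nat -> vec) (x : vec), (forall n, X (u n)) -> in_Vm m x ->
    Un_cv (fun n => norm m (vsub (u n) x)) 0 -> X x.
Definition is_convex (X : vec -> Prop) : Prop :=
  forall x y t, X x -> X y -> 0 <= t <= 1 -> X (comb t x y).

Definition has_gradient_on (m : nat) (O : vec -> Prop) (f : vec -> R) (g : vec -> vec) : Prop :=
  forall x, O x -> in_Vm m (g x) /\
    forall eps, 0 < eps -> exists delta, 0 < delta /\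
      forall y, O y -> norm m (vsub y x) < delta ->
        Rabs (f y - f x - inner m (g x) (vsub y x)) <= eps * norm m (vsub y x).
Definition continuous_on (m : nat) (O : vec -> Prop) (g : vec -> vec) : Prop :=
  forall x, O x -> forall eps, 0 < eps -> exists delta, 0 < delta /\
    forall y, O y -> norm m (vsub y x) < delta -> norm m (vsub (g y) (g x)) < eps.
Definition C1_on (m : nat) (O : vec -> Prop) (f : vec -> R) (g : vec -> vec) : Prop :=
  has_gradient_on m O f g /\ continuous_on m O g.

Definition lipschitz_on (m : nat) (S : vec -> Prop) (g : vec -> vec) (L : R) : Prop :=
  forall x y, S x -> S y -> norm m (vsub (g x) (g y)) <= L * norm m (vsub x y).

Definition convex_fun_on (O : vec -> Prop) (G : vec -> R) : Prop :=
  forall x y t, O x -> O y -> 0 <= t <= 1 -> O (comb t x y) ->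
    G (comb t x y) <= t * G x + (1 - t) * G y.
Definition strongly_convex_on (m : nat) (S : vec -> Prop) (f : vec -> R) (tau : R) : Prop :=
  forall x y t, S x -> S y -> 0 <= t <= 1 ->
    f (comb t x y) <= t * f x + (1 - t) * f y
                      - tau / 2 * t * (1 - t) * (norm m (vsub x y)) ^ 2.

(* Digraphs on nodes {0,...,I-1}: E j i means (j,i) is an edge (j sends to i) *)
Definition digraph := nat -> nat -> Prop.
Definition strongly_connected (I : nat) (E : digraph) : Prop :=
  forall i j, (i < I)%nat -> (j < I)%nat ->
    clos_refl_trans nat (fun a b => (a < I)%nat /\ (b < I)%nat /\ E a b) i j.
Definition B_strongly_connected (I : nat) (Ek : nat -> digraph) : Prop :=
  exists B : nat, (0 < B)%nat /\ forall k,
    strongly_connected I (fun a b => exists t, (k <= t < k + B)%nat /\ Ek t a b).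

Definition compliant (I : nat) (Ek : nat -> digraph) (A : nat -> nat -> nat -> R)
  (kappa : R) (k : nat) : Prop :=
  forall i j, (i < I)%nat -> (j < I)%nat ->
    (j <> i -> ~ Ek k j i -> A k i j = 0) /\
    (Ek k j i -> kappa <= A k i j) /\
    kappa <= A k i i.
Definition col_stochastic (I : nat) (A : nat -> nat -> nat -> R) (k : nat) : Prop :=
  (forall i j, (i < I)%nat -> (j < I)%nat -> 0 <= A k i j) /\
  (forall j, (j < I)%nat -> rsum I (fun i => A k i j) = 1).

Definition is_argmin (X : vec -> Prop) (phi : vec -> R) (z : vec) : Prop :=
  X z /\ forall w, X w -> phi z <= phi w.

(* The SONATA iteration; x k i = x_(i)^k, xt k i = tilde x_i^k,
   xh k i = x_(i)^(k+1/2), phi k i = phi_(i)^k, y k i = y_(i)^k. *)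
Definition sonata (m I : nat) (X : vec -> Prop) (G : vec -> R)
  (grad : nat -> vec -> vec) (ft : nat -> vec -> vec -> R)
  (gamma : nat -> R) (A : nat -> nat -> nat -> R)
  (x xt xh : nat -> nat -> vec) (phi : nat -> nat -> R) (y : nat -> nat -> vec) : Prop :=
  (forall i, (i < I)%nat -> X (x 0%nat i) /\ phi 0%nat i = 1 /\ y 0%nat i = grad i (x 0%nat i)) /\
  (forall k i, (i < I)%nat ->
     is_argmin X (fun z => ft i z (x k i)
                           + inner m (vsub (vscal (INR I) (y k i)) (grad i (x k i))) (vsub z (x k i))
                           + G z) (xt k i) /\
     xh k i = vadd (x k i) (vscal (gamma k) (vsub (xt k i) (x k i))) /\
     phi (S k) i = rsum I (fun j => A k i j * phi k j) /\
     x (S k) i = vscal (/ phi (S k) i) (vsum I (fun j => vscal (A k i j * phi k j) (xh k j))) /\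
     y (S k) i = vadd (vscal (/ phi (S k) i) (vsum I (fun j => vscal (A k i j * phi k j) (y k j))))
                      (vscal (/ phi (S k) i) (vsub (grad i (x (S k) i)) (grad i (x k i))))).

Definition xbar (I : nat) (x : nat -> nat -> vec) (k : nat) : vec :=
  vscal (/ INR I) (vsum I (fun i => x k i)).
Definition gradF (I : nat) (grad : nat -> vec -> vec) (z : vec) : vec :=
  vsum I (fun i => grad i z).

(* argmin_{y in X} { gF^T (y - xb) + 1/2 ||y - xb||^2 + G y } (unique when it exists) *)
Definition prox_pt (m : nat) (X : vec -> Prop) (G : vec -> R) (gF xb : vec) : vec :=
  epsilon (inhabits vzero)
    (is_argmin X (fun w => inner m gF (vsub w xb) + / 2 * (norm m (vsub w xb)) ^ 2 + G w)).

Definition Jmerit (m I : nat) (X : vec -> Prop) (G : vec -> R) (grad : nat -> vec -> vec)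
  (xb : vec) : R :=
  norm m (vsub xb (prox_pt m X G (gradF I grad xb) xb)).
Definition Dmerit (m I : nat) (x : nat -> nat -> vec) (k : nat) : R :=
  sqrt (rsum I (fun i => (norm m (vsub (x k i) (xbar I x k))) ^ 2)).
Definition Mmerit (m I : nat) (X : vec -> Prop) (G : vec -> R) (grad : nat -> vec -> vec)
  (x : nat -> nat -> vec) (k : nat) : R :=
  Rmax ((Jmerit m I X G grad (xbar I x k)) ^ 2) ((Dmerit m I x k) ^ 2).

(* Main.v *)
(** The weighted averages [xphi] (weights [phi / n]) evolve along the averaged directions
    only, and the weighted average of the [y] variables is exactly the average gradient. Hence
    the potential F(xphi) + (1/n) sum_i phi_i G(x_i) decreases by a multiple of gamma times
    the squared direction norm, up to gamma times that norm times the disagreement of the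
    agents. The matrix products over [n * B] steps have entries bounded below, so the
    disagreements are majorized by linear recursions [rx], [ry] contracting at rate rho and
    driven by gamma times the direction norm; adding squares of [rx], [ry] to the potential
    absorbs the cross terms once gamma is small. The resulting decrement also controls the
    growth of J^2 at [xphi], so J^2 converges, and its limit is 0 because the step sizes are
    not summable. *)

Require Import Defs.
From Stdlib Require Import Reals Lra Lia Psatz List Relations.
From Stdlib Require Import Classical ClassicalEpsilon FunctionalExtensionality.
Open Scope R_scope.

(** * Finite sums and Euclidean vectors *)

(** Column stochasticity preserves sums but not plain averages, which is why the weights [phi]
    appear: the ratios [z] of pushed sums are averaged with row-stochastic weights once the matrix
    products are rescaled by [phi]. The true disagreement need not shrink at each step, only over a
    window of [n * B] steps, so it cannot enter a one-step Lyapunov function. Its majorants shrink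
    at every step up to a perturbation, which is what the decrement requires. Summing the decrement
    only shows that gamma times J^2 is summable, hence that J^2 is small along a subsequence.
    Bounding the one-step growth of J^2 by the same decrement upgrades this to convergence of the
    whole sequence. [G] is nonsmooth, so optimality is handled throughout by variational
    inequalities, and J is defined by a choice operator, so existence of the proximal point has to
    be proved before J can be estimated. All constants ([rho], [C], [lb], [alpha], [gbar]) are fixed
    before any run is considered; this makes the threshold in (b) depend on the data alone, and (a)
    reduces to the same bound because vanishing steps eventually lie below [gbar]. *)

Lemma Rabs_bounds a b : Rabs a <= b -> - b <= a <= b.
Proof.
  intros H. pose proof (Rle_abs a). pose proof (Rle_abs (- a)). rewrite Rabs_Ropp in *. lra.
Qed.

Lemma rsum_ext n f g :
  (forall i, (i < n)%nat -> f i = g i) -> rsum n f = rsum n g.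
Proof.
  induction n as [|n IH]; simpl; intros H; [reflexivity|].
  rewrite IH by (intros; apply H; lia). rewrite H by lia. reflexivity.
Qed.

Lemma rsum_le n f g :
  (forall i, (i < n)%nat -> f i <= g i) -> rsum n f <= rsum n g.
Proof.
  induction n as [|n IH]; simpl; intros H; [lra|].
  apply Rplus_le_compat; [apply IH; intros; apply H|apply H]; lia.
Qed.

Lemma rsum_plus n f g : rsum n (fun i => f i + g i) = rsum n f + rsum n g.
Proof. induction n as [|n IH]; simpl; [lra|rewrite IH; lra]. Qed.

Lemma rsum_scal n c f : rsum n (fun i => c * f i) = c * rsum n f.
Proof. induction n as [|n IH]; simpl; [lra|rewrite IH; lra]. Qed.

Lemma rsum_minus n f g : rsum n (fun i => f i - g i) = rsum n f - rsum n g.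
Proof. induction n as [|n IH]; simpl; [lra|rewrite IH; lra]. Qed.

Lemma rsum_const n c : rsum n (fun _ => c) = INR n * c.
Proof. induction n as [|n IH]; [simpl; lra|]. rewrite S_INR. simpl. rewrite IH. lra. Qed.

Lemma rsum_nonneg n f : (forall i, (i < n)%nat -> 0 <= f i) -> 0 <= rsum n f.
Proof.
  intros H. replace 0 with (rsum n (fun _ => 0)) by (rewrite rsum_const; ring).
  now apply rsum_le.
Qed.

Lemma rsum_abs n f : Rabs (rsum n f) <= rsum n (fun i => Rabs (f i)).
Proof.
  induction n as [|n IH]; simpl; [rewrite Rabs_R0; lra|].
  eapply Rle_trans; [apply Rabs_triang|lra].
Qed.

Lemma rsum_swap n p (f : nat -> nat -> R) :
  rsum n (fun i => rsum p (fun j => f i j)) = rsum p (fun j => rsum n (fun i => f i j)).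
Proof.
  induction n as [|n IH]; simpl; [now rewrite rsum_const, Rmult_0_r|].
  rewrite IH, <- rsum_plus. reflexivity.
Qed.

Lemma rsum_term_le n f i :
  (forall j, (j < n)%nat -> 0 <= f j) -> (i < n)%nat -> f i <= rsum n f.
Proof.
  induction n as [|n IH]; intros H Hi; [lia|]. simpl.
  assert (Hs : 0 <= rsum n f) by (apply rsum_nonneg; intros; apply H; lia).
  assert (Hn : 0 <= f n) by (apply H; lia).
  destruct (Nat.eq_dec i n) as [->|Hne]; [lra|].
  assert (f i <= rsum n f) by (apply IH; [intros; apply H|]; lia). lra.
Qed.

Lemma exists_upper_bound n (f : nat -> R) :
  exists C, 0 < C /\ forall i, (i < n)%nat -> Rabs (f i) <= C.
Proof.
  assert (Hp : forall j, (j < n)%nat -> 0 <= Rabs (f j)) by (intros; apply Rabs_pos).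
  exists (rsum n (fun i => Rabs (f i)) + 1). split.
  - pose proof (rsum_nonneg n _ Hp). lra.
  - intros i Hi. pose proof (rsum_term_le n _ i Hp Hi). cbv beta in *. lra.
Qed.

Lemma exists_positive_lower_bound n (f : nat -> R) :
  (forall i, (i < n)%nat -> 0 < f i) ->
  exists c, 0 < c /\ forall i, (i < n)%nat -> c <= f i.
Proof.
  induction n as [|n IH]; intros H; [exists 1; split; [lra|intros; lia]|].
  destruct IH as [c [Hc Hb]]; [intros; apply H; lia|].
  exists (Rmin c (f n)). split.
  - apply Rmin_glb_lt; [lra|apply H; lia].
  - intros i Hi. destruct (Nat.eq_dec i n) as [->|Hne]; [apply Rmin_r|].
    eapply Rle_trans; [apply Rmin_l|apply Hb; lia].
Qed.

Ltac vec_ring := apply functional_extensionality; intro; unfold comb, vadd, vsub, vscal; ring.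

Lemma inner_comm m x y : inner m x y = inner m y x.
Proof. apply rsum_ext; intros; ring. Qed.

Lemma inner_add_l m x y z : inner m (vadd x y) z = inner m x z + inner m y z.
Proof. unfold inner. rewrite <- rsum_plus. apply rsum_ext; intros; unfold vadd; ring. Qed.

Lemma inner_sub_l m x y z : inner m (vsub x y) z = inner m x z - inner m y z.
Proof. unfold inner. rewrite <- rsum_minus. apply rsum_ext; intros; unfold vsub; ring. Qed.

Lemma inner_scal_l m c x y : inner m (vscal c x) y = c * inner m x y.
Proof. unfold inner. rewrite <- rsum_scal. apply rsum_ext; intros; unfold vscal; ring. Qed.

Lemma inner_add_r m x y z : inner m z (vadd x y) = inner m z x + inner m z y.
Proof. rewrite inner_comm, inner_add_l, (inner_comm m x), (inner_comm m y). ring. Qed.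

Lemma inner_sub_r m x y z : inner m z (vsub x y) = inner m z x - inner m z y.
Proof. rewrite inner_comm, inner_sub_l, (inner_comm m x), (inner_comm m y). ring. Qed.

Lemma inner_scal_r m c x y : inner m x (vscal c y) = c * inner m x y.
Proof. rewrite inner_comm, inner_scal_l, inner_comm. ring. Qed.

Lemma inner_vsum_l m n f z : inner m (vsum n f) z = rsum n (fun i => inner m (f i) z).
Proof.
  unfold inner, vsum. rewrite rsum_swap. apply rsum_ext; intros.
  rewrite Rmult_comm, <- rsum_scal. apply rsum_ext; intros; ring.
Qed.

Lemma inner_vsum_r m n f z : inner m z (vsum n f) = rsum n (fun i => inner m z (f i)).
Proof.
  rewrite inner_comm, inner_vsum_l. apply rsum_ext; intros. apply inner_comm.
Qed.

Lemma inner_self_nonneg m x : 0 <= inner m x x.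
Proof. apply rsum_nonneg; intros; nra. Qed.

Lemma norm_nonneg m x : 0 <= norm m x.
Proof. apply sqrt_pos. Qed.

Lemma norm_sqr m x : norm m x ^ 2 = inner m x x.
Proof. unfold norm. rewrite pow2_sqrt; [reflexivity|apply inner_self_nonneg]. Qed.

Lemma norm_le_of_sqr m x b : 0 <= b -> inner m x x <= b ^ 2 -> norm m x <= b.
Proof. intros Hb H. rewrite <- norm_sqr in H. pose proof (norm_nonneg m x). nra. Qed.

Lemma coord_le_norm m x c : (c < m)%nat -> Rabs (x c) <= norm m x.
Proof.
  intros Hc. unfold norm. rewrite <- sqrt_Rsqr_abs. apply sqrt_le_1_alt. unfold Rsqr.
  apply (rsum_term_le m (fun j => x j * x j)); [intros; nra|exact Hc].
Qed.

Lemma cauchy_schwarz m x y : Rabs (inner m x y) <= norm m x * norm m y.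
Proof.
  pose proof (norm_sqr m x) as Hx. pose proof (norm_sqr m y) as Hy.
  pose proof (norm_nonneg m x) as Px. pose proof (norm_nonneg m y) as Py.
  destruct (Req_dec (norm m y) 0) as [H0|H0].
  - replace (inner m x y) with 0; [rewrite Rabs_R0; nra|].
    symmetry. unfold inner. replace 0 with (rsum m (fun _ => 0)) by (rewrite rsum_const; ring).
    apply rsum_ext; intros c Hc. pose proof (coord_le_norm m y c Hc) as Hl.
    rewrite H0 in Hl. pose proof (Rabs_pos (y c)).
    destruct (Req_dec (y c) 0) as [->|Hne]; [ring|]. apply Rabs_no_R0 in Hne. lra.
  - assert (Hp : 0 < norm m y ^ 2) by nra.
    (* This vector is [norm m y ^ 2] times the component of [x] orthogonal to [y]; its squared norm
       expands to the claim times a positive factor. *)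
    pose proof (inner_self_nonneg m (vsub (vscal (norm m y ^ 2) x) (vscal (inner m x y) y))) as Hq.
    repeat rewrite ?inner_sub_l, ?inner_sub_r, ?inner_scal_l, ?inner_scal_r in Hq.
    rewrite (inner_comm m y x), <- Hx, <- Hy in Hq.
    assert (Hs : inner m x y ^ 2 <= (norm m x * norm m y) ^ 2) by nra.
    rewrite <- (Rabs_pos_eq (norm m x * norm m y)) by nra.
    apply Rsqr_le_abs_0. unfold Rsqr. nra.
Qed.

Lemma inner_le_norm m x y : inner m x y <= norm m x * norm m y.
Proof. eapply Rle_trans; [apply Rle_abs|apply cauchy_schwarz]. Qed.

Lemma norm_add m x y : norm m (vadd x y) <= norm m x + norm m y.
Proof.
  pose proof (norm_nonneg m x). pose proof (norm_nonneg m y).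
  apply norm_le_of_sqr; [lra|].
  repeat rewrite ?inner_add_l, ?inner_add_r. rewrite (inner_comm m y x), <- !norm_sqr.
  pose proof (inner_le_norm m x y). nra.
Qed.

Lemma norm_scal m c x : norm m (vscal c x) = Rabs c * norm m x.
Proof.
  unfold norm. rewrite inner_scal_l, inner_scal_r, <- Rmult_assoc, sqrt_mult_alt by nra.
  f_equal. apply sqrt_Rsqr_abs.
Qed.

Lemma norm_sub_comm m x y : norm m (vsub x y) = norm m (vsub y x).
Proof.
  replace (vsub x y) with (vscal (-1) (vsub y x)) by vec_ring.
  rewrite norm_scal, Rabs_left by lra. lra.
Qed.

Lemma norm_sub_triangle m x y z :
  norm m (vsub x z) <= norm m (vsub x y) + norm m (vsub y z).
Proof.
  replace (vsub x z) with (vadd (vsub x y) (vsub y z)) by vec_ring. apply norm_add.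
Qed.

Lemma norm_vsum m n f : norm m (vsum n f) <= rsum n (fun i => norm m (f i)).
Proof.
  induction n as [|n IH].
  - change (vsum 0 f) with vzero. replace vzero with (vscal 0 vzero) by (unfold vzero; vec_ring).
    rewrite norm_scal, Rabs_R0. simpl. lra.
  - change (vsum (S n) f) with (vadd (vsum n f) (f n)). simpl.
    eapply Rle_trans; [apply norm_add|lra].
Qed.

Lemma norm_le_coords m x b :
  0 <= b -> (forall c, (c < m)%nat -> Rabs (x c) <= b) -> norm m x <= INR m * b.
Proof.
  intros Hb H. pose proof (pos_INR m) as Hm. apply norm_le_of_sqr; [nra|].
  apply Rle_trans with (rsum m (fun _ => b ^ 2)).
  - apply rsum_le; intros c Hc. pose proof (H c Hc) as Hc'.
    rewrite <- (Rabs_pos_eq b Hb) in Hc'. apply Rsqr_le_abs_1 in Hc'. unfold Rsqr in Hc'. nra.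
  - rewrite rsum_const. destruct m as [|m]; [simpl; nra|].
    assert (1 <= INR (S m)) by (rewrite S_INR; pose proof (pos_INR m); lra). nra.
Qed.

Lemma convex_comb_dev n (p z : nat -> R) w b :
  (forall i, (i < n)%nat -> 0 <= p i) -> rsum n p = 1 ->
  (forall i, (i < n)%nat -> Rabs (z i - w) <= b) ->
  Rabs (rsum n (fun i => p i * z i) - w) <= b.
Proof.
  intros Hp H1 Hz.
  replace (rsum n (fun i => p i * z i) - w) with (rsum n (fun i => p i * (z i - w))).
  - eapply Rle_trans; [apply rsum_abs|].
    replace b with (rsum n (fun i => b * p i)) by (rewrite rsum_scal, H1; ring).
    apply rsum_le; intros i Hi. rewrite Rabs_mult, (Rabs_pos_eq (p i)) by auto.
    pose proof (Hz i Hi). pose proof (Hp i Hi). nra.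
  - rewrite (rsum_ext n (fun i => p i * (z i - w)) (fun i => p i * z i - w * p i))
      by (intros; ring).
    rewrite rsum_minus, rsum_scal, H1. ring.
Qed.

(** * Convex analysis and the proximal problem *)

(** The weights are left unnormalized because the algorithm averages with [A k i j * phi k j], of
    total mass [phi (S k) i], and with [phi], of total mass [n]. The induction merges the average of
    the first [n] points with the last one; if the earlier weights all vanish, the average is the
    last point itself. *)
Lemma jensen X G n (p : nat -> R) (z : nat -> vec) :
  is_convex X -> convex_fun_on X G ->
  (forall i, (i < n)%nat -> 0 <= p i) -> (forall i, (i < n)%nat -> X (z i)) ->
  0 < rsum n p ->
  X (vscal (/ rsum n p) (vsum n (fun i => vscal (p i) (z i)))) /\
  G (vscal (/ rsum n p) (vsum n (fun i => vscal (p i) (z i))))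
    <= / rsum n p * rsum n (fun i => p i * G (z i)).
Proof.
  intros HX HG. induction n as [|n IH]; intros Hp Hz Hs; [simpl in Hs; lra|].
  simpl in Hs. set (P := rsum n p) in *.
  assert (HP : 0 <= P) by (apply rsum_nonneg; intros; apply Hp; lia).
  assert (Hq : 0 <= p n) by (apply Hp; lia).
  assert (Hn : X (z n)) by (apply Hz; lia).
  destruct (Req_dec P 0) as [H0|H0].
  - assert (Hpz : forall i, (i < n)%nat -> p i = 0).
    { intros i Hi. apply Rle_antisym; [|apply Hp; lia]. rewrite <- H0.
      apply rsum_term_le; [intros; apply Hp; lia|exact Hi]. }
    assert (Hz0 : forall f : nat -> R, rsum n (fun i => p i * f i) = 0).
    { intros f. rewrite (rsum_ext n _ (fun _ => 0)), rsum_const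
        by (intros; rewrite Hpz by lia; ring).
      ring. }
    replace (vscal (/ rsum (S n) p) (vsum (S n) (fun i => vscal (p i) (z i)))) with (z n).
    + split; [exact Hn|]. simpl. rewrite Hz0. fold P. rewrite H0. right. field. lra.
    + apply functional_extensionality; intro c. unfold vscal, vsum. simpl.
      rewrite Hz0. fold P. rewrite H0. field. lra.
  - destruct IH as [IX IG]; [intros; apply Hp; lia|intros; apply Hz; lia|lra|].
    set (w := vscal (/ P) (vsum n (fun i => vscal (p i) (z i)))) in *.
    assert (Ht : 0 <= P / (P + p n) <= 1).
    { split; [apply Rle_mult_inv_pos; lra|].
      apply Rmult_le_reg_r with (P + p n); [lra|]. unfold Rdiv.
      rewrite Rmult_assoc, Rinv_l by lra. lra. }
    replace (vscal (/ rsum (S n) p) (vsum (S n) (fun i => vscal (p i) (z i))))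
      with (comb (P / (P + p n)) w (z n)).
    + assert (Hc : X (comb (P / (P + p n)) w (z n))) by (apply HX; assumption).
      split; [exact Hc|]. eapply Rle_trans; [apply HG; assumption|]. simpl. fold P.
      replace (/ (P + p n) * (rsum n (fun i => p i * G (z i)) + p n * G (z n)))
        with (P / (P + p n) * (/ P * rsum n (fun i => p i * G (z i)))
              + (1 - P / (P + p n)) * G (z n)) by (field; lra).
      apply Rplus_le_compat_r, Rmult_le_compat_l; [apply Ht|exact IG].
    + apply functional_extensionality; intro c. unfold w, comb, vadd, vscal, vsum. simpl.
      fold P. field. lra.
Qed.

Lemma le_of_forall_eps a b K :
  0 <= K -> (forall eps, 0 < eps -> a <= b + K * eps) -> a <= b.
Proof.
  intros HK H. apply Rnot_lt_le. intros Hlt.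
  pose proof (H ((a - b) / (2 * (K + 1)))) as H1.
  assert (Hp : 0 < (a - b) / (2 * (K + 1))) by (apply Rdiv_lt_0_compat; lra).
  specialize (H1 Hp).
  assert ((a - b) / (2 * (K + 1)) * (2 * (K + 1)) = a - b) by (field; lra). nra.
Qed.

Lemma small_step N delta eps :
  0 <= N -> 0 < delta -> 0 < eps -> exists t, 0 < t <= 1 /\ t <= eps /\ t * N < delta.
Proof.
  intros HN Hd He. exists (Rmin 1 (Rmin eps (delta / (N + 1)))).
  assert (Hq : 0 < delta / (N + 1)) by (apply Rdiv_lt_0_compat; lra).
  pose proof (Rmin_l 1 (Rmin eps (delta / (N + 1)))).
  pose proof (Rmin_r 1 (Rmin eps (delta / (N + 1)))).
  pose proof (Rmin_l eps (delta / (N + 1))). pose proof (Rmin_r eps (delta / (N + 1))).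
  set (t := Rmin 1 _) in *.
  assert (0 < t) by (repeat apply Rmin_glb_lt; lra).
  assert (delta / (N + 1) * (N + 1) = delta) by (field; lra).
  repeat split; try lra. nra.
Qed.

Lemma comb_sub t x w : vsub (comb t w x) x = vscal t (vsub w x).
Proof. vec_ring. Qed.

(** Strong convexity at [comb t w x], combined with the first-order expansion at [x], is divided by
    [t], and [t] tends to 0. *)
Lemma strongly_convex_first_order m X O s g tau x w :
  is_convex X -> (forall z, X z -> O z) -> strongly_convex_on m X s tau -> 0 <= tau ->
  has_gradient_on m O s g -> X x -> X w ->
  s x + inner m (g x) (vsub w x) + tau / 2 * norm m (vsub w x) ^ 2 <= s w.
Proof.
  intros HX HXO Hs Htau Hg Hx Hw. set (N := norm m (vsub w x)).
  assert (HN : 0 <= N) by apply norm_nonneg.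
  (* Two errors are proportional to [eps]: the gradient remainder [N * eps], and
     [tau / 2 * t * N ^ 2] with [t <= eps]. *)
  apply le_of_forall_eps with (N + tau / 2 * N ^ 2); [nra|]. intros eps Heps.
  destruct (Hg x (HXO x Hx)) as [_ Hd]. destruct (Hd eps Heps) as [delta [Hdel Hd']].
  destruct (small_step N delta eps HN Hdel Heps) as [t [Ht [Hte HtN]]].
  assert (Ht' : 0 <= t <= 1) by lra.
  pose proof (Hs w x t Hw Hx Ht') as H1.
  specialize (Hd' (comb t w x) (HXO _ (HX w x t Hw Hx Ht'))).
  rewrite comb_sub, norm_scal, Rabs_pos_eq, inner_scal_r in Hd' by lra.
  fold N in H1, Hd'. specialize (Hd' HtN). apply Rabs_bounds in Hd'.
  apply Rmult_le_reg_l with t; [lra|].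
  assert (tau / 2 * t * t * N ^ 2 <= tau / 2 * t * eps * N ^ 2).
  { apply Rmult_le_compat_r; [nra|]. apply Rmult_le_compat_l; [nra|lra]. }
  nra.
Qed.

Lemma strongly_monotone_gradient m X O s g tau x w :
  is_convex X -> (forall z, X z -> O z) -> strongly_convex_on m X s tau -> 0 <= tau ->
  has_gradient_on m O s g -> X x -> X w ->
  tau * norm m (vsub w x) ^ 2 <= inner m (vsub (g w) (g x)) (vsub w x).
Proof.
  intros HX HXO Hs Ht Hg Hx Hw.
  pose proof (strongly_convex_first_order m X O s g tau x w HX HXO Hs Ht Hg Hx Hw) as H1.
  pose proof (strongly_convex_first_order m X O s g tau w x HX HXO Hs Ht Hg Hw Hx) as H2.
  rewrite (norm_sub_comm m x w) in H2. rewrite inner_sub_l.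
  replace (vsub x w) with (vscal (-1) (vsub w x)) in H2 by vec_ring.
  rewrite inner_scal_r in H2. lra.
Qed.

(** A short move from [p] towards [z] cannot lower [Phi]; convexity of [G] makes its increment
    linear in the step. The smooth part is only required to have an upper first-order expansion,
    with the increment of [G] kept exact, so that the same lemma serves the proximal objective and
    the agents' subproblems. *)
Lemma argmin_variational m X G (Phi : vec -> R) p g :
  is_convex X -> convex_fun_on X G -> is_argmin X Phi p ->
  (forall eps, 0 < eps -> exists delta, 0 < delta /\ forall w, X w ->
     norm m (vsub w p) < delta ->
     Phi w - Phi p <= inner m g (vsub w p) + eps * norm m (vsub w p) + (G w - G p)) ->
  forall z, X z -> 0 <= inner m g (vsub z p) + G z - G p.
Proof.
  intros HX HG [Hp Hmin] Hd z Hz. set (N := norm m (vsub z p)).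
  assert (HN : 0 <= N) by apply norm_nonneg.
  apply le_of_forall_eps with N; [exact HN|]. intros eps Heps.
  destruct (Hd eps Heps) as [delta [Hdel Hd']].
  destruct (small_step N delta 1 HN Hdel Rlt_0_1) as [t [Ht [_ HtN]]].
  assert (Ht' : 0 <= t <= 1) by lra.
  assert (Hc : X (comb t z p)) by (apply HX; assumption).
  specialize (Hd' _ Hc). rewrite comb_sub, norm_scal, Rabs_pos_eq, inner_scal_r in Hd' by lra.
  fold N in Hd'. specialize (Hd' HtN). pose proof (Hmin _ Hc).
  pose proof (HG z p t Hz Hp Ht' Hc). apply Rmult_le_reg_l with t; [lra|]. nra.
Qed.

Lemma in_Vm_comb m t x y : in_Vm m x -> in_Vm m y -> in_Vm m (comb t x y).
Proof.
  intros Hx Hy j Hj. unfold comb, vadd, vscal. rewrite Hx, Hy by assumption. ring.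
Qed.

(* The sharp constant [L / 2] is not needed, so the mean value theorem replaces an integral. *)
Lemma descent_lemma m X O f g L x y :
  is_convex X -> is_open m O -> (forall z, O z -> in_Vm m z) -> (forall z, X z -> O z) ->
  has_gradient_on m O f g -> lipschitz_on m X g L -> X x -> X y ->
  f y <= f x + inner m (g x) (vsub y x) + Rabs L * norm m (vsub y x) ^ 2.
Proof.
  intros HX HO HV HXO Hg HL Hx Hy. set (N := norm m (vsub y x)).
  assert (HN : 0 <= N) by apply norm_nonneg.
  assert (Hder : forall t, 0 <= t <= 1 ->
    derivable_pt_lim (fun t => f (comb t y x)) t (inner m (g (comb t y x)) (vsub y x))).
  { intros t Ht eps Heps.
    assert (Hc : O (comb t y x)) by (apply HXO, HX; assumption).
    destruct (Hg _ Hc) as [_ Hd].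
    destruct (Hd (eps / (2 * (N + 1)))) as [d1 [Hd1 Hd']]; [apply Rdiv_lt_0_compat; lra|].
    destruct (HO _ Hc) as [r [Hr Hball]].
    assert (Hd0 : 0 < Rmin d1 r / (N + 1))
      by (apply Rdiv_lt_0_compat; [apply Rmin_glb_lt; assumption|lra]).
    exists (mkposreal _ Hd0). intros h Hh Hhd. simpl in Hhd.
    assert (Hsub : vsub (comb (t + h) y x) (comb t y x) = vscal h (vsub y x)) by vec_ring.
    assert (HhN : Rabs h * N < Rmin d1 r).
    { apply (Rmult_lt_compat_r (N + 1)) in Hhd; [|lra]. unfold Rdiv in Hhd.
      rewrite Rmult_assoc, Rinv_l in Hhd by lra. pose proof (Rabs_pos h). nra. }
    pose proof (Rmin_l d1 r). pose proof (Rmin_r d1 r).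
    (* At an endpoint [t + h] may leave [0,1] and the point may leave [X]; openness of [O] keeps it
       in the domain of [f]. *)
    assert (HOh : O (comb (t + h) y x)).
    { apply Hball; [apply in_Vm_comb; apply HV, HXO; assumption|].
      rewrite Hsub, norm_scal. fold N. lra. }
    specialize (Hd' _ HOh). rewrite Hsub, norm_scal, inner_scal_r in Hd'. fold N in Hd'.
    assert (Hd2 : Rabs h * N < d1) by lra. specialize (Hd' Hd2).
    set (l := inner m (g (comb t y x)) (vsub y x)) in *.
    replace ((f (comb (t + h) y x) - f (comb t y x)) / h - l)
      with ((f (comb (t + h) y x) - f (comb t y x) - h * l) / h) by (field; assumption).
    unfold Rdiv. rewrite Rabs_mult, Rabs_inv.
    pose proof (Rabs_pos_lt h Hh) as Hah.
    apply Rmult_lt_reg_r with (Rabs h); [lra|].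
    rewrite Rmult_assoc, Rinv_l by lra. rewrite Rmult_1_r.
    eapply Rle_lt_trans; [exact Hd'|].
    assert (He : eps / (2 * (N + 1)) * (2 * (N + 1)) = eps) by (field; lra).
    assert (0 < eps / (2 * (N + 1))) by (apply Rdiv_lt_0_compat; lra).
    assert (eps / (2 * (N + 1)) * N < eps) by nra. nra. }
  destruct (MVT_cor2 (fun t => f (comb t y x)) _ 0 1 Rlt_0_1 Hder) as [t [Heq Ht]].
  replace (comb 1 y x) with y in Heq by vec_ring.
  replace (comb 0 y x) with x in Heq by vec_ring.
  assert (Ht' : 0 <= t <= 1) by lra.
  pose proof (inner_le_norm m (vsub (g (comb t y x)) (g x)) (vsub y x)) as Hi.
  rewrite inner_sub_l in Hi. fold N in Hi.
  pose proof (HL (comb t y x) x (HX y x t Hy Hx Ht') Hx) as Hl.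
  rewrite comb_sub, norm_scal, Rabs_pos_eq in Hl by lra. fold N in Hl.
  pose proof (Rle_abs L). pose proof (Rabs_pos L).
  assert (norm m (vsub (g (comb t y x)) (g x)) <= Rabs L * N).
  { eapply Rle_trans; [exact Hl|]. apply Rle_trans with (Rabs L * (t * N)).
    - apply Rmult_le_compat_r; nra.
    - apply Rmult_le_compat_l; nra. }
  nra.
Qed.

(** * Lower semicontinuity of convex functions on an open set *)

Definition unit_vec (j : nat) : vec := fun c => if Nat.eq_dec c j then 1 else 0.

(** Induction on the number [j] of coordinates in which [d] may be nonzero. A displacement is the
    midpoint of twice its first coordinates and twice its last one; the latter lies on a coordinate
    axis, where convexity gives a bound linear in the distance. *)
Lemma convex_locally_bounded_above m O G x :
  convex_fun_on O G -> is_open m O -> (forall z, O z -> in_Vm m z) -> O x ->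
  forall j, (j <= m)%nat -> forall eps, 0 < eps ->
  exists delta, 0 < delta /\ forall d, in_Vm j d -> (forall c, Rabs (d c) <= delta) ->
    O (vadd x d) /\ G (vadd x d) <= G x + eps.
Proof.
  intros HG HO HV Hx. pose proof (HV x Hx) as HVx.
  destruct (HO x Hx) as [r [Hr Hball]].
  assert (Hm : 0 <= INR m) by apply pos_INR.
  (* A vector whose coordinates are at most [r0] has norm at most [INR m * r0 < r], so the whole
     cube of half-width [r0] lies in the ball. *)
  set (r0 := r / (2 * (INR m + 1))).
  assert (Hr0 : 0 < r0) by (apply Rdiv_lt_0_compat; lra).
  assert (Hr0' : r0 * (2 * (INR m + 1)) = r) by (unfold r0; field; lra).
  assert (Hcube : forall d, in_Vm m d -> (forall c, Rabs (d c) <= r0) -> O (vadd x d)).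
  { intros d Hd Hb. apply Hball.
    - intros c Hc. unfold vadd. rewrite Hd, HVx by assumption. ring.
    - replace (vsub (vadd x d) x) with d by vec_ring.
      eapply Rle_lt_trans; [apply norm_le_coords with (b := r0); [lra|auto]|]. nra. }
  induction j as [|j IH]; intros Hj eps Heps.
  - exists 1. split; [lra|]. intros d Hd _.
    replace (vadd x d) with x; [split; [assumption|lra]|].
    apply functional_extensionality; intro c. unfold vadd. rewrite (Hd c) by lia. ring.
  - destruct (IH ltac:(lia) eps Heps) as [d0 [Hd0 IH']].
    assert (Hu : forall a, Rabs a <= r0 ->
      O (vadd x (vscal a (unit_vec j)))).
    { intros a Ha. apply Hcube.
      - intros c Hc. unfold vscal, unit_vec. destruct (Nat.eq_dec c j); [lia|ring].
      - intros c. unfold vscal, unit_vec. destruct (Nat.eq_dec c j).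
        + now rewrite Rmult_1_r.
        + rewrite Rmult_0_r, Rabs_R0. lra. }
    (* [M] dominates the increase of [G] at both ends of the axis segment, so the sign of [a] does
       not affect the bound. *)
    set (M := Rabs (G (vadd x (vscal r0 (unit_vec j))) - G x)
              + Rabs (G (vadd x (vscal (- r0) (unit_vec j))) - G x)).
    assert (HM : 0 <= M) by (unfold M; apply Rplus_le_le_0_compat; apply Rabs_pos).
    assert (Hline : forall a, Rabs a <= r0 ->
      G (vadd x (vscal a (unit_vec j))) <= G x + Rabs a / r0 * M).
    { intros a Ha.
      assert (Hs : exists b, Rabs b = r0 /\ a = Rabs a / r0 * b /\
                   G (vadd x (vscal b (unit_vec j))) - G x <= M).
      { destruct (Rle_dec 0 a) as [Hp|Hp].
        - exists r0. rewrite (Rabs_pos_eq a), (Rabs_pos_eq r0) by lra.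
          split; [reflexivity|split; [field; lra|]]. unfold M.
          pose proof (Rle_abs (G (vadd x (vscal r0 (unit_vec j))) - G x)).
          pose proof (Rabs_pos (G (vadd x (vscal (- r0) (unit_vec j))) - G x)). lra.
        - exists (- r0). rewrite Rabs_Ropp, (Rabs_left a), (Rabs_pos_eq r0) by lra.
          split; [reflexivity|split; [field; lra|]]. unfold M.
          pose proof (Rle_abs (G (vadd x (vscal (- r0) (unit_vec j))) - G x)).
          pose proof (Rabs_pos (G (vadd x (vscal r0 (unit_vec j))) - G x)). lra. }
      destruct Hs as [b [Hb [Hab HMb]]].
      assert (Hs : 0 <= Rabs a / r0 <= 1).
      { pose proof (Rabs_pos a). split; [apply Rle_mult_inv_pos; lra|].
        apply Rmult_le_reg_r with r0; [lra|]. unfold Rdiv.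
        rewrite Rmult_assoc, Rinv_l by lra. lra. }
      assert (Hc : vadd x (vscal a (unit_vec j))
                   = comb (Rabs a / r0) (vadd x (vscal b (unit_vec j))) x).
      { rewrite Hab at 1. vec_ring. }
      assert (Hin := Hu a Ha). rewrite Hc in Hin |- *.
      eapply Rle_trans; [apply HG; [apply Hu; lra|assumption|assumption|assumption]|]. nra. }
    (* Doubling must keep the first coordinates within [d0] and the last one within [r0]; the third
       bound makes the axis increment [Rabs (2 * d j) / r0 * M] at most [eps]. *)
    set (d1 := Rmin (d0 / 2) (Rmin (r0 / 2) (r0 * eps / (2 * (M + 1))))).
    assert (Hq : 0 < r0 * eps / (2 * (M + 1))) by (apply Rdiv_lt_0_compat; nra).
    assert (Hd1 : 0 < d1) by (unfold d1; repeat apply Rmin_glb_lt; lra).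
    pose proof (Rmin_l (d0 / 2) (Rmin (r0 / 2) (r0 * eps / (2 * (M + 1))))) as L1.
    pose proof (Rmin_r (d0 / 2) (Rmin (r0 / 2) (r0 * eps / (2 * (M + 1))))) as L2.
    pose proof (Rmin_l (r0 / 2) (r0 * eps / (2 * (M + 1)))) as L3.
    pose proof (Rmin_r (r0 / 2) (r0 * eps / (2 * (M + 1)))) as L4.
    fold d1 in L1, L2.
    exists d1. split; [exact Hd1|]. intros d Hd Hb.
    assert (HOd : O (vadd x d)).
    { apply Hcube; [intros c Hc; apply Hd; lia|]. intros c. pose proof (Hb c). lra. }
    split; [exact HOd|].
    set (d' := fun c => if Nat.eq_dec c j then 0 else 2 * d c).
    destruct (IH' d') as [HO1 HG1].
    { intros c Hc. unfold d'. destruct (Nat.eq_dec c j); [reflexivity|].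
      rewrite Hd by lia. ring. }
    { intros c. unfold d'. destruct (Nat.eq_dec c j); [rewrite Rabs_R0; lra|].
      rewrite Rabs_mult, (Rabs_pos_eq 2) by lra. pose proof (Hb c). lra. }
    assert (Ha : Rabs (2 * d j) <= 2 * d1).
    { rewrite Rabs_mult, (Rabs_pos_eq 2) by lra. pose proof (Hb j). lra. }
    assert (Ha' : Rabs (2 * d j) <= r0) by lra.
    pose proof (Hline _ Ha') as HG2.
    assert (Hc : vadd x d = comb (/ 2) (vadd x d') (vadd x (vscal (2 * d j) (unit_vec j)))).
    { apply functional_extensionality; intro c. unfold comb, vadd, vscal, d', unit_vec.
      destruct (Nat.eq_dec c j) as [->|]; field. }
    rewrite Hc in HOd |- *.
    eapply Rle_trans; [apply HG; [assumption|apply Hu; lra|lra|assumption]|].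
    assert (Rabs (2 * d j) / r0 * M <= eps).
    { apply Rmult_le_reg_r with r0; [lra|].
      replace (Rabs (2 * d j) / r0 * M * r0) with (Rabs (2 * d j) * M) by (field; lra).
      assert (r0 * eps / (2 * (M + 1)) * (2 * (M + 1)) = r0 * eps) by (field; lra).
      pose proof (Rabs_pos (2 * d j)). nra. }
    lra.
Qed.

(** [x] is the midpoint of [y] and its reflection [vadd x d], so an upper bound on [G] at the
    reflection is a lower bound at [y]. *)
Lemma convex_lower_semicontinuous m O G x :
  convex_fun_on O G -> is_open m O -> (forall z, O z -> in_Vm m z) -> O x ->
  forall eps, 0 < eps -> exists delta, 0 < delta /\
    forall y, O y -> norm m (vsub y x) < delta -> G x - eps <= G y.
Proof.
  intros HG HO HV Hx eps Heps.
  destruct (convex_locally_bounded_above m O G x HG HO HV Hx m (le_n m) eps Heps)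
    as [delta [Hdel Hup]].
  exists delta. split; [exact Hdel|]. intros y Hy Hyd.
  set (d := vsub x y).
  assert (HVd : in_Vm m d).
  { intros c Hc. unfold d, vsub. rewrite (HV x Hx c Hc), (HV y Hy c Hc). ring. }
  destruct (Hup d HVd) as [HOd HGd].
  { intros c. destruct (Nat.lt_ge_cases c m) as [Hc|Hc].
    - pose proof (coord_le_norm m d c Hc) as Hn. unfold d in *.
      rewrite norm_sub_comm in Hn. lra.
    - rewrite (HVd c Hc), Rabs_R0. lra. }
  assert (Hc : x = comb (/ 2) y (vadd x d))
    by (apply functional_extensionality; intro c; unfold comb, vadd, vscal, d, vsub; field).
  assert (Hle : G (comb (/ 2) y (vadd x d)) <= / 2 * G y + (1 - / 2) * G (vadd x d)).
  { apply HG; [assumption|assumption|lra|]. rewrite <- Hc. exact Hx. }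
  rewrite <- Hc in Hle. lra.
Qed.

Lemma eventually_forall_lt n (P : nat -> nat -> Prop) :
  (forall c, (c < n)%nat -> exists N, forall k, (N <= k)%nat -> P c k) ->
  exists N, forall k, (N <= k)%nat -> forall c, (c < n)%nat -> P c k.
Proof.
  induction n as [|n IH]; intros H; [exists 0%nat; intros; lia|].
  destruct IH as [N1 H1]; [intros; apply H; lia|].
  destruct (H n) as [N2 H2]; [lia|].
  exists (max N1 N2). intros k Hk c Hc.
  destruct (Nat.eq_dec c n) as [->|]; [apply H2|apply H1]; lia.
Qed.

Lemma norm_cv_of_coords m (u : nat -> vec) p :
  (forall c, (c < m)%nat -> Un_cv (fun n => u n c) (p c)) ->
  Un_cv (fun n => norm m (vsub (u n) p)) 0.
Proof.
  intros H eps Heps. pose proof (pos_INR m) as Hm.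
  set (e := eps / (INR m + 1)).
  assert (He : 0 < e) by (apply Rdiv_lt_0_compat; lra).
  destruct (eventually_forall_lt m (fun c n => Rdist (u n c) (p c) < e)) as [N HN].
  { intros c Hc. destruct (H c Hc e He) as [N HN]. exists N. intros; apply HN; lia. }
  exists N. intros n Hn. unfold Rdist. rewrite Rminus_0_r, Rabs_pos_eq by apply norm_nonneg.
  apply Rle_lt_trans with (INR m * e).
  - apply norm_le_coords; [lra|]. intros c Hc. left. exact (HN n Hn c Hc).
  - assert (e * (INR m + 1) = eps) by (unfold e; field; lra). nra.
Qed.

(** Parallelogram identity centred at [z]. Its last term is the convexity gain that makes minimizing
    sequences of the proximal objective Cauchy. *)
Lemma comb_half_norm m a b z :
  norm m (vsub (comb (/ 2) a b) z) ^ 2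
  = / 2 * norm m (vsub a z) ^ 2 + / 2 * norm m (vsub b z) ^ 2 - / 4 * norm m (vsub a b) ^ 2.
Proof.
  replace (vsub (comb (/ 2) a b) z) with (vscal (/ 2) (vadd (vsub a z) (vsub b z)))
    by (apply functional_extensionality; intro; unfold comb, vadd, vsub, vscal; field).
  replace (vsub a b) with (vsub (vsub a z) (vsub b z)) by vec_ring.
  rewrite !norm_sqr. repeat rewrite ?inner_scal_l, ?inner_scal_r.
  set (p := vsub a z). set (q := vsub b z).
  repeat rewrite ?inner_add_l, ?inner_add_r, ?inner_sub_l, ?inner_sub_r.
  rewrite (inner_comm m q p). field.
Qed.

Lemma prox_variational m X G c a p :
  is_convex X -> convex_fun_on X G ->
  is_argmin X (fun w => inner m c (vsub w a) + / 2 * norm m (vsub w a) ^ 2 + G w) p ->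
  forall z, X z -> 0 <= inner m (vadd c (vsub p a)) (vsub z p) + G z - G p.
Proof.
  intros HX HG Hp. apply (argmin_variational _ _ _ _ _ _ HX HG Hp).
  (* The remainder of the quadratic is exactly half of [norm m d ^ 2], so [delta := eps]
     suffices. *)
  intros eps Heps. exists eps. split; [exact Heps|]. intros w _ Hw.
  replace (vsub w a) with (vadd (vsub w p) (vsub p a)) by vec_ring.
  rewrite !norm_sqr. set (d := vsub w p) in *.
  repeat rewrite ?inner_add_l, ?inner_add_r. rewrite (inner_comm m (vsub p a) d), <- !norm_sqr.
  pose proof (norm_nonneg m d). nra.
Qed.

(** Each variational inequality is tested at the other point; in the sum [G] cancels and strong
    monotonicity of the proximal term leaves the squared distance. The point [w] may solve a
    different problem with gradient [g]: it will be another proximal point, or the solution of an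
    agent's subproblem. *)
Lemma prox_dist m X G c a p g w :
  is_convex X -> convex_fun_on X G ->
  is_argmin X (fun w => inner m c (vsub w a) + / 2 * norm m (vsub w a) ^ 2 + G w) p ->
  X w -> (forall z, X z -> 0 <= inner m g (vsub z w) + G z - G w) ->
  norm m (vsub p w) <= norm m (vsub (vsub g c) (vsub w a)).
Proof.
  intros HX HG Hp Hw Hvi. pose proof (Hvi p (proj1 Hp)) as H1.
  pose proof (prox_variational m X G c a p HX HG Hp w Hw) as H2.
  set (d := vsub p w) in *. set (h := vsub (vsub g c) (vsub w a)).
  replace (vadd c (vsub p a)) with (vadd (vsub g h) d) in H2 by (unfold h, d; vec_ring).
  replace (vsub w p) with (vscal (-1) d) in H2 by (unfold d; vec_ring).
  rewrite inner_scal_r, inner_add_l, inner_sub_l, <- norm_sqr in H2.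
  pose proof (inner_le_norm m h d). pose proof (norm_nonneg m d). pose proof (norm_nonneg m h).
  assert (norm m d * norm m d <= norm m h * norm m d) by nra.
  destruct (Req_dec (norm m d) 0); nra.
Qed.

(** Lower semicontinuity bounds [G] below near [a]; convexity along the segment back to [a] extends
    this to a bound decreasing at most linearly, which the quadratic term dominates. *)
Lemma prox_objective_bounded_below m X O G c a :
  is_convex X -> convex_fun_on O G -> is_open m O -> (forall z, O z -> in_Vm m z) ->
  (forall z, X z -> O z) -> X a ->
  exists b, forall w, X w ->
    b <= inner m c (vsub w a) + / 2 * norm m (vsub w a) ^ 2 + G w.
Proof.
  intros HX HG HO HV HXO Ha.
  destruct (convex_lower_semicontinuous m O G a HG HO HV (HXO a Ha) 1 Rlt_0_1)
    as [delta [Hdel Hl]].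
  assert (Hlin : forall w, X w -> G a - 1 - 2 / delta * norm m (vsub w a) <= G w).
  { intros w Hw. set (N := norm m (vsub w a)). assert (HN : 0 <= N) by apply norm_nonneg.
    assert (Hd2 : 0 < 2 / delta) by (apply Rdiv_lt_0_compat; lra).
    destruct (Rlt_le_dec N delta) as [Hlt|Hge].
    - pose proof (Hl w (HXO w Hw) Hlt). nra.
    (* This [t] brings the point to distance [delta / 2] from [a], inside the region where [G] is
       already bounded. *)
    - set (t := delta / (2 * N)).
      assert (Ht0 : 0 < t) by (apply Rdiv_lt_0_compat; lra).
      assert (HtN : t * N = delta / 2) by (unfold t; field; lra).
      assert (Ht : 0 <= t <= 1) by nra.
      assert (Hc : X (comb t w a)) by (apply HX; assumption).
      assert (G a - 1 <= G (comb t w a)) as H1.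
      { apply Hl; [apply HXO; exact Hc|].
        rewrite comb_sub, norm_scal, Rabs_pos_eq by lra. fold N. lra. }
      pose proof (HG w a t (HXO w Hw) (HXO a Ha) Ht (HXO _ Hc)) as H2.
      assert (H3 : t * (2 / delta * N) = 1).
      { replace (t * (2 / delta * N)) with (2 / delta * (t * N)) by ring. rewrite HtN. field. lra. }
      apply Rmult_le_reg_l with t; [exact Ht0|]. nra. }
  (* The subtracted square comes from minimizing [/ 2 * N ^ 2 - (norm m c + 2 / delta) * N] over
     [N]. *)
  exists (G a - 1 - / 2 * (norm m c + 2 / delta) ^ 2). intros w Hw.
  pose proof (Hlin w Hw). pose proof (cauchy_schwarz m c (vsub w a)) as Hcs.
  apply Rabs_bounds in Hcs. set (N := norm m (vsub w a)) in *.
  pose proof (Rle_0_sqr (N - (norm m c + 2 / delta))) as Hsq. unfold Rsqr in Hsq. nra.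
Qed.

Lemma minimizing_sequence (X : vec -> Prop) (h : vec -> R) :
  (exists z, X z) -> (exists b, forall w, X w -> b <= h w) ->
  exists inf (u : nat -> vec), (forall w, X w -> inf <= h w) /\
    forall n, X (u n) /\ h (u n) < inf + / INR (S n).
Proof.
  intros [z Hz] [b Hb].
  destruct (completeness (fun r => exists w, X w /\ r = - h w)) as [M [Hub Hlub]].
  - exists (- b). intros r [w [Hw ->]]. pose proof (Hb w Hw). lra.
  - exists (- h z), z. auto.
  - assert (Hex : forall n, exists w, X w /\ h w < - M + / INR (S n)).
    { intros n. apply NNPP. intros Hno.
      assert (Hpos : 0 < / INR (S n)) by (apply Rinv_0_lt_compat, lt_0_INR; lia).
      assert (M <= M - / INR (S n)); [|lra]. apply Hlub. intros r [w [Hw ->]].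
      apply Rnot_lt_le. intros Hlt. apply Hno. exists w. split; [exact Hw|lra]. }
    exists (- M), (fun n => proj1_sig (constructive_indefinite_description _ (Hex n))).
    split.
    + intros w Hw. assert (- h w <= M) by (apply Hub; exists w; auto). lra.
    + intros n. exact (proj2_sig (constructive_indefinite_description _ (Hex n))).
Qed.

Lemma inv_INR_S_small eps : 0 < eps -> exists N, forall n, (N <= n)%nat -> / INR (S n) < eps.
Proof.
  intros He. destruct (archimed_cor1 eps He) as [N [HN HN0]]. exists N. intros n Hn.
  eapply Rle_lt_trans; [|exact HN].
  apply Rinv_le_contravar; [apply lt_0_INR; lia|apply le_INR; lia].
Qed.

(** Direct method: a minimizing sequence is Cauchy by the parallelogram identity, its limit lies in
    the closed set [X], and lower semicontinuity of [G] makes the limit a minimizer. *)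
Lemma prox_exists m X O G c a :
  is_convex X -> is_closed m X -> convex_fun_on O G -> is_open m O ->
  (forall z, O z -> in_Vm m z) -> (forall z, X z -> O z) -> X a ->
  exists p, is_argmin X (fun w => inner m c (vsub w a) + / 2 * norm m (vsub w a) ^ 2 + G w) p.
Proof.
  intros HX Hcl HG HO HV HXO Ha.
  set (h := fun w => inner m c (vsub w a) + / 2 * norm m (vsub w a) ^ 2 + G w).
  destruct (minimizing_sequence X h) as [inf [u [Hinf Hu]]].
  { exists a; exact Ha. }
  { apply prox_objective_bounded_below with O; assumption. }
  (* The midpoint has value at least [inf], while it undercuts the mean of the two values by an
     eighth of their squared distance. *)
  assert (Hclose : forall n k,
    norm m (vsub (u n) (u k)) ^ 2 <= 4 * (/ INR (S n) + / INR (S k))).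
  { intros n k. destruct (Hu n) as [Xn Hn]. destruct (Hu k) as [Xk Hk].
    assert (Hhalf : 0 <= / 2 <= 1) by lra.
    assert (Hc : X (comb (/ 2) (u n) (u k))) by (apply HX; assumption).
    pose proof (Hinf _ Hc) as Hi. unfold h in Hi, Hn, Hk.
    rewrite comb_half_norm in Hi.
    replace (vsub (comb (/ 2) (u n) (u k)) a)
      with (vadd (vscal (/ 2) (vsub (u n) a)) (vscal (/ 2) (vsub (u k) a))) in Hi
      by (apply functional_extensionality; intro; unfold comb, vadd, vsub, vscal; field).
    rewrite inner_add_r, !inner_scal_r in Hi.
    pose proof (HG _ _ _ (HXO _ Xn) (HXO _ Xk) Hhalf (HXO _ Hc)). lra. }
  assert (Hlim : forall j, {l | (j < m)%nat -> Un_cv (fun n => u n j) l}).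
  { intros j. destruct (Compare_dec.lt_dec j m) as [Hj|Hj]; [|exists 0; intros; contradiction].
    destruct (R_complete (fun n => u n j)) as [l Hl].
    - intros eps Heps. destruct (inv_INR_S_small (eps ^ 2 / 8)) as [N HN]; [nra|].
      exists N. intros n k Hn Hk. unfold Rdist.
      pose proof (coord_le_norm m (vsub (u n) (u k)) j Hj) as Hco.
      unfold vsub at 1 in Hco. eapply Rle_lt_trans; [exact Hco|].
      pose proof (HN n Hn). pose proof (HN k Hk). pose proof (Hclose n k).
      pose proof (norm_nonneg m (vsub (u n) (u k))). nra.
    - exists l. auto. }
  (* Coordinates beyond [m] are set to 0, since closedness of [X] speaks only of limits in
     [in_Vm m]. *)
  set (p := fun j => if Compare_dec.lt_dec j m then proj1_sig (Hlim j) else 0).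
  assert (Hcv : Un_cv (fun n => norm m (vsub (u n) p)) 0).
  { apply norm_cv_of_coords. intros j Hj. unfold p.
    destruct (Compare_dec.lt_dec j m) as [H|H]; [|lia].
    exact (proj2_sig (Hlim j) H). }
  assert (Xp : X p).
  { apply Hcl with u; [intros; apply Hu| |exact Hcv].
    intros j Hj. unfold p. destruct (Compare_dec.lt_dec j m); [lia|reflexivity]. }
  exists p. split; [exact Xp|]. intros w Hw. apply Rle_trans with inf; [|apply Hinf, Hw].
  set (K := norm m (vadd c (vsub p a))).
  assert (HK : 0 <= K) by apply norm_nonneg.
  (* One [eps] is the gap of [u n] to the infimum, one is the loss in lower semicontinuity, and
     [K * eps] bounds the linear term of the expansion at [p]. *)
  apply le_of_forall_eps with (K + 2); [lra|]. intros eps Heps.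
  destruct (convex_lower_semicontinuous m O G p HG HO HV (HXO p Xp) eps Heps)
    as [delta [Hdel Hl]].
  destruct (Hcv (Rmin delta eps)) as [N1 HN1]; [apply Rmin_glb_lt; assumption|].
  destruct (inv_INR_S_small eps Heps) as [N2 HN2].
  set (n := max N1 N2). specialize (HN1 n ltac:(lia)). specialize (HN2 n ltac:(lia)).
  unfold Rdist in HN1. rewrite Rminus_0_r, Rabs_pos_eq in HN1 by apply norm_nonneg.
  pose proof (Rmin_l delta eps). pose proof (Rmin_r delta eps).
  destruct (Hu n) as [Xn Hn]. specialize (Hl (u n) (HXO _ Xn)).
  assert (Hd : norm m (vsub (u n) p) < delta) by lra. specialize (Hl Hd).
  pose proof (cauchy_schwarz m (vadd c (vsub p a)) (vsub (u n) p)) as Hcs.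
  apply Rabs_bounds in Hcs. fold K in Hcs.
  assert (Hexp : h (u n) - G (u n) = h p - G p + inner m (vadd c (vsub p a)) (vsub (u n) p)
                                     + / 2 * norm m (vsub (u n) p) ^ 2).
  { unfold h. replace (vsub (u n) a) with (vadd (vsub (u n) p) (vsub p a)) by vec_ring.
    rewrite !norm_sqr. set (d := vsub (u n) p).
    repeat rewrite ?inner_add_l, ?inner_add_r. rewrite (inner_comm m d (vsub p a)). field. }
  pose proof (norm_nonneg m (vsub (u n) p)).
  change (h p <= inf + (K + 2) * eps). nra.
Qed.

(** * Perturbed consensus over time-varying digraphs *)

Lemma rsum_delta n i (f : nat -> R) :
  (i < n)%nat -> rsum n (fun j => (if Nat.eq_dec i j then 1 else 0) * f j) = f i.
Proof.
  assert (Hz : forall p, (p <= i)%nat ->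
    rsum p (fun j => (if Nat.eq_dec i j then 1 else 0) * f j) = 0).
  { induction p as [|p IH]; intros Hp; simpl; [reflexivity|].
    rewrite IH by lia. destruct (Nat.eq_dec i p); [lia|ring]. }
  induction n as [|n IH]; intros Hi; [lia|]. simpl.
  destruct (Nat.eq_dec i n) as [->|Hne]; [rewrite Hz by lia; ring|rewrite IH by lia; ring].
Qed.

Lemma exists_min_index n (z : nat -> R) :
  (0 < n)%nat -> exists i, (i < n)%nat /\ forall j, (j < n)%nat -> z i <= z j.
Proof.
  induction n as [|n IH]; intros Hn; [lia|].
  destruct n as [|n].
  { exists 0%nat. split; [lia|]. intros j Hj. replace j with 0%nat by lia. lra. }
  destruct IH as [i [Hi Hmin]]; [lia|].
  destruct (Rle_dec (z i) (z (S n))) as [Hle|Hle]; [exists i|exists (S n)];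
    (split; [lia|]); intros j Hj; destruct (Nat.eq_dec j (S n)) as [->|];
    try (pose proof (Hmin j ltac:(lia))); lra.
Qed.

(** Both averages contain the common part with weight [q] on every entry, which cancels in the
    difference. Only the remaining mass [1 - INR n * q] can separate them, and it acts on values
    between the minimum and the minimum plus [S]. *)
Lemma stochastic_contraction n (p p' z : nat -> R) q S :
  (0 < n)%nat ->
  (forall i, (i < n)%nat -> q <= p i) -> (forall i, (i < n)%nat -> q <= p' i) ->
  rsum n p = 1 -> rsum n p' = 1 ->
  (forall i j, (i < n)%nat -> (j < n)%nat -> Rabs (z i - z j) <= S) ->
  rsum n (fun i => p i * z i) - rsum n (fun i => p' i * z i) <= (1 - INR n * q) * S.
Proof.
  intros Hn Hp Hp' H1 H1' HS. destruct (exists_min_index n z Hn) as [j0 [Hj0 Hmin]].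
  assert (Hup : rsum n (fun i => (p i - q) * z i) <= (1 - INR n * q) * (z j0 + S)).
  { apply Rle_trans with (rsum n (fun i => (z j0 + S) * (p i - q))).
    - apply rsum_le; intros i Hi. pose proof (HS i j0 Hi Hj0) as Hd. apply Rabs_bounds in Hd.
      pose proof (Hp i Hi). nra.
    - rewrite rsum_scal, rsum_minus, H1, rsum_const. lra. }
  assert (Hlo : (1 - INR n * q) * z j0 <= rsum n (fun i => (p' i - q) * z i)).
  { apply Rle_trans with (rsum n (fun i => z j0 * (p' i - q))).
    - rewrite rsum_scal, rsum_minus, H1', rsum_const. lra.
    - apply rsum_le; intros i Hi. pose proof (Hmin i Hi). pose proof (Hp' i Hi). nra. }
  rewrite (rsum_ext n _ (fun i => p i * z i - q * z i)), rsum_minus in Hup by (intros; ring).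
  rewrite (rsum_ext n _ (fun i => p' i * z i - q * z i)), rsum_minus in Hlo by (intros; ring).
  lra.
Qed.

Lemma crossing_edge (E : nat -> nat -> Prop) (T : nat -> Prop) a b :
  clos_refl_trans nat E a b -> T a -> ~ T b -> exists u v, E u v /\ T u /\ ~ T v.
Proof.
  induction 1 as [a b Hab|a|a b c _ IH1 _ IH2]; intros Ha Hb.
  - exists a, b. auto.
  - contradiction.
  - destruct (classic (T b)); [apply IH2|apply IH1]; assumption.
Qed.

(** Entry [(i, j)] of the product of the matrices at times [k + N - 1] down to [k], the latest one
    leftmost. *)
Fixpoint transition (n : nat) (A : nat -> nat -> nat -> R) (k N i j : nat) : R :=
  match N with
  | O => if Nat.eq_dec i j then 1 else 0
  | S N' => rsum n (fun l => A (k + N')%nat i l * transition n A k N' l j)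
  end.

Lemma transition_nonneg n A k N i j :
  (forall k, col_stochastic n A k) -> (i < n)%nat -> (j < n)%nat ->
  0 <= transition n A k N i j.
Proof.
  intros HA Hi Hj. revert i Hi. induction N as [|N IH]; intros i Hi; simpl.
  - destruct (Nat.eq_dec i j); lra.
  - apply rsum_nonneg; intros l Hl. apply Rmult_le_pos; [apply HA; assumption|auto].
Qed.

Lemma transition_step_lower n A kappa k N i l j :
  (forall k, col_stochastic n A k) -> 0 < kappa ->
  (i < n)%nat -> (l < n)%nat -> (j < n)%nat ->
  kappa <= A (k + N)%nat i l -> kappa ^ N <= transition n A k N l j ->
  kappa ^ S N <= transition n A k (S N) i j.
Proof.
  intros HA Hk Hi Hl Hj H1 H2. simpl.
  apply Rle_trans with (A (k + N)%nat i l * transition n A k N l j).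
  - apply Rmult_le_compat; [lra|apply pow_le; lra|exact H1|exact H2].
  - apply (rsum_term_le n (fun l => A (k + N)%nat i l * transition n A k N l j));
      [|exact Hl].
    intros l' Hl'. apply Rmult_le_pos; [apply HA; assumption|apply transition_nonneg; assumption].
Qed.

(** A node once reached stays reached through its self-loop, at the cost of one factor [kappa] per
    step. *)
Lemma transition_self_loops n Ek A kappa k N d i j :
  (forall k, col_stochastic n A k) -> 0 < kappa -> (forall k, compliant n Ek A kappa k) ->
  (i < n)%nat -> (j < n)%nat ->
  kappa ^ N <= transition n A k N i j ->
  kappa ^ (N + d) <= transition n A k (N + d) i j.
Proof.
  intros HA Hk Hc Hi Hj H. induction d as [|d IH]; [now rewrite Nat.add_0_r|].
  rewrite Nat.add_succ_r. apply transition_step_lower with i; try assumption.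
  now apply (Hc (k + (N + d))%nat i i).
Qed.

(* Every window of length [B] has an edge leaving the set reached from [j], as long as
   some node is not reached yet. *)
Lemma transition_reach n Ek A kappa B k j r :
  (forall k, col_stochastic n A k) -> 0 < kappa -> (forall k, compliant n Ek A kappa k) ->
  (forall k, strongly_connected n (fun a b => exists t, (k <= t < k + B)%nat /\ Ek t a b)) ->
  (j < n)%nat ->
  (forall i, (i < n)%nat -> kappa ^ (r * B) <= transition n A k (r * B) i j) \/
  exists l, NoDup l /\ length l = S r /\
    forall i, In i l -> (i < n)%nat /\ kappa ^ (r * B) <= transition n A k (r * B) i j.
Proof.
  intros HA Hk Hc HB Hj.
  set (T := fun N i => kappa ^ N <= transition n A k N i j).
  assert (Hmono : forall N d i, (i < n)%nat -> T N i -> T (N + d)%nat i).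
  { intros N d i Hi. apply transition_self_loops with Ek; assumption. }
  induction r as [|r IH].
  - right. exists (j :: nil). split; [constructor; [intros []|constructor]|].
    split; [reflexivity|]. intros i [<-|[]]. split; [exact Hj|]. simpl.
    destruct (Nat.eq_dec j j); [lra|contradiction].
  - replace (S r * B)%nat with (r * B + B)%nat by lia. destruct IH as [Hall|[l [Hnd [Hlen Hl]]]].
    { left. intros i Hi. apply Hmono; [exact Hi|apply Hall, Hi]. }
    destruct (classic (forall i, (i < n)%nat -> T (r * B)%nat i)) as [Hall|Hno].
    { left. intros i Hi. apply Hmono; [exact Hi|apply Hall, Hi]. }
    right. apply not_all_ex_not in Hno. destruct Hno as [b Hno].
    apply imply_to_and in Hno. destruct Hno as [Hb HTb].
    destruct l as [|a l']; [discriminate|].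
    destruct (Hl a (or_introl eq_refl)) as [Ha HTa].
    destruct (crossing_edge _ (T (r * B)%nat) a b (HB (k + r * B)%nat a b Ha Hb) HTa HTb)
      as [u [v [[Hu [Hv [t [Ht He]]]] [HTu HTv]]]].
    exists (v :: a :: l'). split; [|split].
    + constructor; [|exact Hnd]. intros Hin. apply HTv, Hl, Hin.
    + simpl in *. lia.
    + intros i [<-|Hin].
      * split; [exact Hv|].
        (* Mass waits at [u] until time [t], crosses to [v] at time [t], and waits at [v] until the
           window ends. The [S] counts the step at time [t] itself. *)
        replace (r * B + B)%nat with (S (t - k) + (k + r * B + B - S t))%nat by lia.
        apply Hmono; [exact Hv|]. apply transition_step_lower with u; try assumption.
        -- replace (k + (t - k))%nat with t by lia. now apply (Hc t v u Hv Hu).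
        -- replace (t - k)%nat with (r * B + (t - k - r * B))%nat by lia. now apply Hmono.
      * destruct (Hl i Hin). split; [assumption|]. now apply Hmono.
Qed.

(** After [n] windows the second alternative of [transition_reach] would list [n + 1] distinct nodes
    below [n]. *)
Lemma transition_positive n Ek A kappa B k i j :
  (forall k, col_stochastic n A k) -> 0 < kappa -> (forall k, compliant n Ek A kappa k) ->
  (forall k, strongly_connected n (fun a b => exists t, (k <= t < k + B)%nat /\ Ek t a b)) ->
  (i < n)%nat -> (j < n)%nat ->
  kappa ^ (n * B) <= transition n A k (n * B) i j.
Proof.
  intros HA Hk Hc HB Hi Hj.
  destruct (transition_reach n Ek A kappa B k j n HA Hk Hc HB Hj) as [H|[l [Hnd [Hlen Hl]]]];
    [auto|exfalso].
  assert (Hincl : incl l (seq 0 n)).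
  { intros a Ha. apply in_seq. destruct (Hl a Ha). lia. }
  pose proof (NoDup_incl_length Hnd Hincl) as Hle. rewrite length_seq in Hle. lia.
Qed.

Lemma weights_window n A (phi : nat -> nat -> R) k N i :
  (forall k i, (i < n)%nat -> phi (S k) i = rsum n (fun j => A k i j * phi k j)) ->
  (i < n)%nat ->
  phi (k + N)%nat i = rsum n (fun j => transition n A k N i j * phi k j).
Proof.
  intros Hphi. revert i. induction N as [|N IH]; intros i Hi.
  - simpl. rewrite rsum_delta by exact Hi. now rewrite Nat.add_0_r.
  - rewrite Nat.add_succ_r, Hphi by exact Hi. simpl.
    rewrite (rsum_ext n _ (fun l => rsum n (fun j =>
      A (k + N)%nat i l * transition n A k N l j * phi k j))).
    + rewrite rsum_swap. apply rsum_ext; intros j Hj.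
      rewrite Rmult_comm, <- rsum_scal. apply rsum_ext; intros; ring.
    + intros l Hl. rewrite IH by exact Hl. rewrite <- rsum_scal. apply rsum_ext; intros; ring.
Qed.

Lemma weights_sum n A (phi : nat -> nat -> R) k :
  (forall k, col_stochastic n A k) -> (forall i, (i < n)%nat -> phi 0%nat i = 1) ->
  (forall k i, (i < n)%nat -> phi (S k) i = rsum n (fun j => A k i j * phi k j)) ->
  rsum n (phi k) = INR n.
Proof.
  intros HA H0 Hphi. induction k as [|k IH].
  - rewrite (rsum_ext n _ (fun _ => 1)), rsum_const by exact H0. ring.
  - rewrite (rsum_ext n _ _ (Hphi k)), rsum_swap, <- IH. apply rsum_ext; intros j Hj.
    rewrite (rsum_ext n _ (fun i => phi k j * A k i j)), rsum_scal by (intros; ring).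
    rewrite (proj2 (HA k) j Hj). ring.
Qed.

Lemma compliant_le_1 n Ek A kappa :
  (0 < n)%nat -> (forall k, col_stochastic n A k) -> (forall k, compliant n Ek A kappa k) ->
  kappa <= 1.
Proof.
  intros Hn HA Hc. destruct (HA 0%nat) as [Hpos Hsum].
  rewrite <- (Hsum 0%nat Hn). eapply Rle_trans; [apply (Hc 0%nat 0%nat 0%nat Hn Hn)|].
  apply (rsum_term_le n (fun i => A 0%nat i 0%nat)); [intros; apply Hpos; assumption|exact Hn].
Qed.

(** During the first [n * B] steps the self-loops alone keep [phi k i] above [kappa ^ k]. Afterwards
    the product over the last [n * B] steps has all entries at least [kappa ^ (n * B)], and it acts
    on a total mass of [n]. *)
Lemma weights_lower_bound n Ek A kappa B (phi : nat -> nat -> R) k i :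
  (0 < n)%nat ->
  (forall k, col_stochastic n A k) -> 0 < kappa -> (forall k, compliant n Ek A kappa k) ->
  (forall k, strongly_connected n (fun a b => exists t, (k <= t < k + B)%nat /\ Ek t a b)) ->
  (forall i, (i < n)%nat -> phi 0%nat i = 1) ->
  (forall k i, (i < n)%nat -> phi (S k) i = rsum n (fun j => A k i j * phi k j)) ->
  (i < n)%nat -> kappa ^ (n * B) <= phi k i.
Proof.
  intros Hn HA Hk Hc HB H0 Hphi Hi.
  pose proof (compliant_le_1 n Ek A kappa Hn HA Hc) as Hk1.
  assert (Hpow : forall N, 0 < kappa ^ N) by (intros; apply pow_lt; lra).
  assert (Hself : forall k i, (i < n)%nat -> kappa ^ k <= phi k i).
  { intros q. induction q as [|q IH]; intros l Hl; [rewrite H0 by exact Hl; simpl; lra|].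
    rewrite Hphi by exact Hl. apply Rle_trans with (A q l l * phi q l).
    - simpl. apply Rmult_le_compat; [lra|apply Rlt_le, Hpow|now apply (Hc q l l)|auto].
    - apply (rsum_term_le n (fun j => A q l j * phi q j)); [|exact Hl].
      intros j Hj. apply Rmult_le_pos; [apply HA; assumption|].
      eapply Rle_trans; [apply Rlt_le, (Hpow q)|auto]. }
  destruct (Nat.le_gt_cases k (n * B)) as [Hle|Hgt].
  - eapply Rle_trans; [|apply Hself, Hi].
    replace (n * B)%nat with (k + (n * B - k))%nat by lia. rewrite pow_add.
    assert (kappa ^ (n * B - k) <= 1).
    { rewrite <- (pow1 (n * B - k)). apply pow_incr. lra. }
    pose proof (Hpow k). nra.
  - replace k with (k - n * B + n * B)%nat by lia.
    rewrite (weights_window n A phi _ _ i Hphi Hi).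
    apply Rle_trans with (rsum n (fun j => kappa ^ (n * B) * phi (k - n * B)%nat j)).
    + rewrite rsum_scal, (weights_sum n A phi _ HA H0 Hphi).
      assert (1 <= INR n) by (change 1 with (INR 1); apply le_INR; lia).
      pose proof (Hpow (n * B)%nat). nra.
    + apply rsum_le; intros j Hj. apply Rmult_le_compat_r.
      * eapply Rle_trans; [apply Rlt_le, (Hpow (k - n * B)%nat)|auto].
      * apply transition_positive with Ek; assumption.
Qed.

(** The error is measured relative to [phi] because mixing then transports it without loss: a common
    relative error [e] of the senders becomes the same relative error of the receiver. Errors of
    successive steps therefore simply add. *)
Lemma perturbed_window n A (phi z : nat -> nat -> R) (e : nat -> R) k N i :
  (forall k, col_stochastic n A k) ->
  (forall k i, (i < n)%nat -> phi (S k) i = rsum n (fun j => A k i j * phi k j)) ->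
  (forall k i, (i < n)%nat ->
     Rabs (phi (S k) i * z (S k) i - rsum n (fun j => A k i j * phi k j * z k j))
     <= phi (S k) i * e k) ->
  (i < n)%nat ->
  Rabs (phi (k + N)%nat i * z (k + N)%nat i
        - rsum n (fun j => transition n A k N i j * phi k j * z k j))
  <= phi (k + N)%nat i * rsum N (fun t => e (k + t)%nat).
Proof.
  intros HA Hphi Hz. revert i. induction N as [|N IH]; intros i Hi.
  - rewrite Nat.add_0_r. simpl.
    rewrite (rsum_ext n _ (fun j => (if Nat.eq_dec i j then 1 else 0) * (phi k j * z k j)))
      by (intros; ring).
    rewrite rsum_delta by exact Hi. rewrite Rminus_diag, Rabs_R0. lra.
  - rewrite Nat.add_succ_r.
    change (rsum (S N) (fun t => e (k + t)%nat))
      with (rsum N (fun t => e (k + t)%nat) + e (k + N)%nat).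
    set (P := fun l => rsum n (fun j => transition n A k N l j * phi k j * z k j)) in *.
    assert (Heq : rsum n (fun j => transition n A k (S N) i j * phi k j * z k j)
                  = rsum n (fun l => A (k + N)%nat i l * P l)).
    { unfold P. simpl.
      rewrite (rsum_ext n (fun l => A (k + N)%nat i l * _) (fun l => rsum n (fun j =>
        A (k + N)%nat i l * transition n A k N l j * phi k j * z k j))).
      - rewrite rsum_swap. apply rsum_ext; intros j Hj.
        rewrite Rmult_assoc, Rmult_comm, <- rsum_scal. apply rsum_ext; intros; ring.
      - intros l Hl. rewrite <- rsum_scal. apply rsum_ext; intros; ring. }
    rewrite Heq.
    set (Q := rsum n (fun j => A (k + N)%nat i j * phi (k + N)%nat j * z (k + N)%nat j)).
    replace (phi (S (k + N)) i * z (S (k + N)) i - rsum n (fun l => A (k + N)%nat i l * P l))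
      with ((Q - rsum n (fun l => A (k + N)%nat i l * P l))
            + (phi (S (k + N)) i * z (S (k + N)) i - Q)) by ring.
    eapply Rle_trans; [apply Rabs_triang|]. rewrite Rmult_plus_distr_l.
    apply Rplus_le_compat; [|apply Hz, Hi].
    unfold Q. rewrite <- rsum_minus. eapply Rle_trans; [apply rsum_abs|].
    rewrite Hphi by exact Hi. rewrite Rmult_comm, <- rsum_scal.
    apply rsum_le; intros l Hl. specialize (IH l Hl).
    replace (A (k + N)%nat i l * phi (k + N)%nat l * z (k + N)%nat l - A (k + N)%nat i l * P l)
      with (A (k + N)%nat i l * (phi (k + N)%nat l * z (k + N)%nat l - P l)) by ring.
    assert (HAp : 0 <= A (k + N)%nat i l) by (apply HA; assumption).
    rewrite Rabs_mult, (Rabs_pos_eq (A (k + N)%nat i l)) by exact HAp.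
    eapply Rle_trans; [apply Rmult_le_compat_l; [exact HAp|exact IH]|]. lra.
Qed.

(** The recursion discounts each past term by at most [rho ^ N] over [N] steps, so [r (k + N)]
    controls the undiscounted sum produced by [perturbed_window]. *)
Lemma geometric_comparison (r e : nat -> R) rho k N :
  0 < rho <= 1 -> (forall k, 0 <= e k) -> (forall k, r (S k) = rho * r k + e k) ->
  rho ^ N * (r k + rsum N (fun t => e (k + t)%nat)) <= r (k + N)%nat.
Proof.
  intros Hr He Hrec. induction N as [|N IH]; [simpl; rewrite Nat.add_0_r; lra|].
  rewrite Nat.add_succ_r, Hrec. simpl.
  assert (rho ^ N <= 1) by (rewrite <- (pow1 N); apply pow_incr; lra).
  assert (0 < rho ^ N) by (apply pow_lt; lra).
  pose proof (He (k + N)%nat).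
  assert (rho * rho ^ N <= 1) by nra.
  assert (rho * rho ^ N * e (k + N)%nat <= 1 * e (k + N)%nat) by (apply Rmult_le_compat_r; lra).
  apply (Rmult_le_compat_l rho) in IH; lra.
Qed.

Lemma bernoulli_minus u N : 0 <= u <= 1 -> 1 - INR N * u <= (1 - u) ^ N.
Proof.
  intros Hu. induction N as [|N IH]; [simpl; lra|]. rewrite S_INR. simpl.
  assert (0 <= (1 - u) ^ N <= 1).
  { split; [apply pow_le; lra|].
    apply Rle_trans with (1 ^ N); [apply pow_incr; lra|rewrite pow1; lra]. }
  assert (u * (1 - u) ^ N <= u) by nra. lra.
Qed.

(* Two rows of a product of [N] consecutive weight matrices overlap in mass at least
   [INR n * q]. *)
Lemma perturbed_dispersion n A (phi z : nat -> nat -> R) (e : nat -> R) k N q spread :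
  (0 < n)%nat -> (forall k, col_stochastic n A k) ->
  (forall k i, (i < n)%nat -> phi (S k) i = rsum n (fun j => A k i j * phi k j)) ->
  (forall k i, (i < n)%nat ->
     Rabs (phi (S k) i * z (S k) i
           - rsum n (fun j => A k i j * phi k j * z k j))
     <= phi (S k) i * e k) ->
  (forall k i, (i < n)%nat -> 0 < phi k i) ->
  (forall i j, (i < n)%nat -> (j < n)%nat ->
     q * phi (k + N)%nat i <= transition n A k N i j * phi k j) ->
  (forall i j, (i < n)%nat -> (j < n)%nat -> Rabs (z k i - z k j) <= spread) ->
  forall i j, (i < n)%nat -> (j < n)%nat ->
  Rabs (z (k + N)%nat i - z (k + N)%nat j)
  <= (1 - INR n * q) * spread + 2 * rsum N (fun t => e (k + t)%nat).
Proof.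
  intros Hn HA Hphi Hz Hpos Hq Hspread.
  (* Rescaling by [phi] turns the column-stochastic product into row-stochastic weights acting on
     [z]. *)
  set (w := fun i j => transition n A k N i j * phi k j / phi (k + N)%nat i).
  assert (Hw1 : forall i, (i < n)%nat -> rsum n (w i) = 1).
  { intros i Hi. unfold w, Rdiv.
    rewrite (rsum_ext n _ (fun j => / phi (k + N)%nat i * (transition n A k N i j * phi k j)))
      by (intros; ring).
    rewrite rsum_scal, <- (weights_window n A phi k N i Hphi Hi). apply Rinv_l.
    pose proof (Hpos (k + N)%nat i Hi). lra. }
  assert (Hwq : forall i j, (i < n)%nat -> (j < n)%nat -> q <= w i j).
  { intros i j Hi Hj. pose proof (Hpos (k + N)%nat i Hi). unfold w.
    apply Rmult_le_reg_r with (phi (k + N)%nat i); [assumption|]. unfold Rdiv.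
    rewrite Rmult_assoc, Rinv_l by lra. rewrite Rmult_1_r. auto. }
  assert (Hdev : forall i, (i < n)%nat ->
    Rabs (z (k + N)%nat i - rsum n (fun j => w i j * z k j)) <= rsum N (fun t => e (k + t)%nat)).
  { intros i Hi. pose proof (Hpos (k + N)%nat i Hi) as Hp.
    pose proof (perturbed_window n A phi z e k N i HA Hphi Hz Hi) as Hwin.
    apply Rmult_le_reg_l with (phi (k + N)%nat i); [exact Hp|].
    rewrite <- (Rabs_pos_eq (phi (k + N)%nat i)) at 1 by lra.
    rewrite <- Rabs_mult, Rmult_minus_distr_l, <- rsum_scal.
    rewrite (rsum_ext n _ (fun j => transition n A k N i j * phi k j * z k j)); [exact Hwin|].
    intros j Hj. unfold w. field. lra. }
  assert (Hone : forall i j, (i < n)%nat -> (j < n)%nat ->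
    z (k + N)%nat i - z (k + N)%nat j
    <= (1 - INR n * q) * spread + 2 * rsum N (fun t => e (k + t)%nat)).
  { intros i j Hi Hj. pose proof (Hdev i Hi) as H1. pose proof (Hdev j Hj) as H2.
    apply Rabs_bounds in H1. apply Rabs_bounds in H2.
    pose proof (stochastic_contraction n (w i) (w j) (z k) q spread Hn (fun l => Hwq i l Hi)
      (fun l => Hwq j l Hj) (Hw1 i Hi) (Hw1 j Hj) Hspread). lra. }
  intros i j Hi Hj. apply Rabs_le. pose proof (Hone i j Hi Hj). pose proof (Hone j i Hj Hi). lra.
Qed.

(** Strong induction over windows of length [N]: the disagreement loses a fraction [beta] per
    window, while the majorant [r] loses no more than that fraction. The constants are quantified
    before [phi] and [z], so they depend on the network and weights only; [z] is scalar because the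
    lemma is applied to each coordinate. *)
Lemma perturbed_consensus n Ek A :
  (0 < n)%nat -> B_strongly_connected n Ek ->
  (exists kappa, 0 < kappa /\ forall k, compliant n Ek A kappa k) ->
  (forall k, col_stochastic n A k) ->
  exists rho C lb, 0 < rho < 1 /\ 0 < C /\ 0 < lb /\
  forall phi : nat -> nat -> R,
    (forall i, (i < n)%nat -> phi 0%nat i = 1) ->
    (forall k i, (i < n)%nat -> phi (S k) i = rsum n (fun j => A k i j * phi k j)) ->
    (forall k i, (i < n)%nat -> lb <= phi k i <= INR n) /\
    forall (z : nat -> nat -> R) (e r : nat -> R),
      (forall k, 0 <= e k) ->
      (forall k i, (i < n)%nat ->
         Rabs (phi (S k) i * z (S k) i - rsum n (fun j => A k i j * phi k j * z k j))
         <= phi (S k) i * e k) ->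
      (forall k, r (S k) = rho * r k + e k) ->
      (forall i j, (i < n)%nat -> (j < n)%nat -> Rabs (z 0%nat i - z 0%nat j) <= r 0%nat) ->
      forall k i j, (i < n)%nat -> (j < n)%nat -> Rabs (z k i - z k j) <= C * r k.
Proof.
  intros Hn [B [HB HBs]] [kappa [Hk Hc]] HA.
  pose proof (compliant_le_1 n Ek A kappa Hn HA Hc) as Hk1.
  set (N := (n * B)%nat). assert (HN : (0 < N)%nat) by (unfold N; nia).
  set (lb := kappa ^ N).
  assert (Hlb : 0 < lb <= 1).
  { split; [apply pow_lt; lra|]. unfold lb. rewrite <- (pow1 N). apply pow_incr. lra. }
  assert (HNR : 1 <= INR N) by (change 1 with (INR 1); apply le_INR; lia).
  assert (HnR : 1 <= INR n) by (change 1 with (INR 1); apply le_INR; lia).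
  (* Overlap of two rows over one window: product entries and weights are at least [lb], and the
     normalizing weight is at most [n], so [q] can be [beta / INR n]. *)
  set (beta := lb * lb). assert (Hbeta : 0 < beta <= 1) by (unfold beta; nra).
  (* Bernoulli's inequality then gives [rho ^ N >= 1 - beta / 2]; the factor 2 also keeps [u] below
     one half, so that [rho] is positive. *)
  set (u := beta / (2 * INR N)).
  assert (Hu : INR N * u = beta / 2) by (unfold u; field; lra).
  assert (Hu0 : 0 < u) by (apply Rdiv_lt_0_compat; lra).
  assert (Hu1 : u <= / 2) by nra.
  set (rho := 1 - u).
  assert (Hrho : 0 < rho < 1) by (unfold rho; lra).
  assert (HrN : 1 - beta <= rho ^ N).
  { pose proof (bernoulli_minus u N ltac:(lra)). unfold rho. lra. }
  assert (HrN0 : 0 < rho ^ N) by (apply pow_lt; lra).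
  exists rho, (2 / rho ^ N), lb. split; [exact Hrho|]. split; [apply Rdiv_lt_0_compat; lra|].
  split; [apply Hlb|]. intros phi H0 Hphi.
  assert (Hlow : forall k i, (i < n)%nat -> lb <= phi k i)
    by (intros; apply (weights_lower_bound n Ek A kappa B); assumption).
  assert (Hbd : forall k i, (i < n)%nat -> lb <= phi k i <= INR n).
  { intros k i Hi. split; [auto|]. rewrite <- (weights_sum n A phi k HA H0 Hphi).
    apply rsum_term_le; [|exact Hi]. intros j Hj. pose proof (Hlow k j Hj). lra. }
  split; [exact Hbd|]. intros z e r He Hz Hr Hz0.
  assert (Hpos : forall k i, (i < n)%nat -> 0 < phi k i)
    by (intros k i Hi; pose proof (Hlow k i Hi); lra).
  assert (HC : forall x, 2 / rho ^ N * (rho ^ N * x) = 2 * x) by (intros; field; lra).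
  assert (Hr0 : 0 <= r 0%nat).
  { eapply Rle_trans; [apply Rabs_pos|apply (Hz0 0%nat 0%nat Hn Hn)]. }
  intros k. induction k as [k IH] using (well_founded_induction Wf_nat.lt_wf). intros i j Hi Hj.
  assert (HC0 : 0 < 2 / rho ^ N) by (apply Rdiv_lt_0_compat; lra).
  destruct (Nat.lt_ge_cases k N) as [Hlt|Hge].
  (* Before a full window has elapsed no overlap is available, so [q] is 0 and the factor
     [2 / rho ^ N] alone pays for the missing contraction. *)
  - pose proof (perturbed_dispersion n A phi z e 0%nat k 0 (r 0%nat) Hn HA Hphi Hz Hpos) as Hd.
    assert (Hq : forall i j, (i < n)%nat -> (j < n)%nat ->
      0 * phi (0 + k)%nat i <= transition n A 0 k i j * phi 0%nat j).
    { intros a b Ha Hb. rewrite Rmult_0_l. apply Rmult_le_pos;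
        [apply transition_nonneg; assumption|apply Rlt_le, Hpos, Hb]. }
    specialize (Hd Hq Hz0 i j Hi Hj). simpl in Hd.
    pose proof (geometric_comparison r e rho 0%nat k ltac:(lra) He Hr) as Hg. simpl in Hg.
    assert (Hsum : 0 <= rsum k (fun t => e t)) by (apply rsum_nonneg; auto).
    assert (Hpk : rho ^ N <= rho ^ k).
    { replace N with (k + (N - k))%nat by lia. rewrite pow_add.
      assert (rho ^ (N - k) <= 1) by (rewrite <- (pow1 (N - k)); apply pow_incr; lra).
      pose proof (pow_lt rho k ltac:(lra)). nra. }
    eapply Rle_trans; [exact Hd|].
    apply Rle_trans with (2 / rho ^ N * (rho ^ N * (r 0%nat + rsum k (fun t => e t)))).
    + rewrite HC. lra.
    + apply Rmult_le_compat_l; [lra|]. eapply Rle_trans; [|exact Hg].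
      apply Rmult_le_compat_r; lra.
  - replace k with (k - N + N)%nat by lia. set (k0 := (k - N)%nat).
    set (q := beta / INR n).
    assert (Hnq : INR n * q = beta) by (unfold q; field; lra).
    assert (Hq0 : 0 < q) by (apply Rdiv_lt_0_compat; lra).
    assert (Hq : forall i j, (i < n)%nat -> (j < n)%nat ->
      q * phi (k0 + N)%nat i <= transition n A k0 N i j * phi k0 j).
    { intros a b Ha Hb. apply Rle_trans with (lb * lb).
      - fold beta. rewrite <- Hnq, Rmult_comm. apply Rmult_le_compat_r; [lra|apply Hbd, Ha].
      - apply Rmult_le_compat; [lra|lra| |apply Hlow, Hb].
        apply (transition_positive n Ek A kappa B); assumption. }
    pose proof (perturbed_dispersion n A phi z e k0 N q (2 / rho ^ N * r k0) Hn HA Hphi Hz Hpos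
      Hq (IH k0 ltac:(lia)) i j Hi Hj) as Hd.
    pose proof (geometric_comparison r e rho k0 N ltac:(lra) He Hr) as Hg.
    assert (Hrk : 0 <= r k0).
    { assert (Hx : 0 <= 2 / rho ^ N * r k0).
      { eapply Rle_trans; [apply Rabs_pos|apply (IH k0 ltac:(lia) i i Hi Hi)]. }
      nra. }
    apply (Rmult_le_compat_l (2 / rho ^ N)) in Hg; [|lra].
    rewrite HC in Hg. eapply Rle_trans; [exact Hd|]. eapply Rle_trans; [|exact Hg].
    rewrite Hnq.
    (* The contraction [1 - beta] is at most [rho ^ N], which cancels the denominator of the
       constant. *)
    assert ((1 - beta) * (2 / rho ^ N * r k0) <= 2 * r k0).
    { rewrite <- HC. assert (0 <= 2 / rho ^ N * r k0) by nra. nra. }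
    lra.
Qed.

(** * Lyapunov sequences *)

Lemma eventually_decreasing_cv (u : nat -> R) b K :
  (forall k, (K <= k)%nat -> u (S k) <= u k) -> (forall k, b <= u k) ->
  exists l, Un_cv u l.
Proof.
  intros Hdec Hb.
  destruct (decreasing_cv (fun k => u (K + k)%nat)) as [l Hl].
  - intros k. rewrite Nat.add_succ_r. apply Hdec. lia.
  - exists (- b). intros y [k ->]. unfold opp_seq. pose proof (Hb (K + k)%nat). lra.
  - exists l. intros eps Heps. destruct (Hl eps Heps) as [N HN].
    exists (K + N)%nat. intros n Hn. replace n with (K + (n - K))%nat by lia. apply HN. lia.
Qed.

Lemma cv_zero_of_le (u v : nat -> R) :
  (exists N, forall n, (N <= n)%nat -> 0 <= u n <= v n) -> Un_cv v 0 -> Un_cv u 0.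
Proof.
  intros [N1 H] Hv eps Heps. destruct (Hv eps Heps) as [N2 H2].
  exists (max N1 N2). intros n Hn. specialize (H n ltac:(lia)). specialize (H2 n ltac:(lia)).
  unfold Rdist in *. rewrite Rminus_0_r in *. apply Rabs_def2 in H2.
  rewrite Rabs_pos_eq by lra. lra.
Qed.

Lemma cv_scal (u : nat -> R) l c : Un_cv u l -> Un_cv (fun n => c * u n) (c * l).
Proof.
  intros H. apply (CV_mult (fun _ => c)); [|exact H].
  intros eps Heps. exists 0%nat. intros. unfold Rdist. rewrite Rminus_diag, Rabs_R0. exact Heps.
Qed.

(* [Lam] and [c q + C Lam] are both eventually nonincreasing and bounded below, so [q]
   converges; a positive limit would make the step sizes summable. *)
Lemma merit_vanishes (gam w Lam q : nat -> R) c C b K :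
  0 < c -> 0 <= C -> (forall k, 0 <= w k) ->
  (forall k, (K <= k)%nat -> Lam (S k) <= Lam k - c * w k) -> (forall k, b <= Lam k) ->
  (forall k, 0 <= q k) -> (forall k, q (S k) <= q k + C * w k) ->
  (forall k, 0 < gam k) -> (forall k, gam k * q k <= C * w k) ->
  cv_infty (fun n => sum_f_R0 gam n) ->
  Un_cv w 0 /\ Un_cv q 0.
Proof.
  intros Hc HC Hw HL Hb Hq Hqs Hg Hgq Hinf.
  destruct (eventually_decreasing_cv Lam b K) as [l1 Hl1].
  { intros k Hk. pose proof (HL k Hk). pose proof (Hw k). nra. }
  { exact Hb. }
  destruct (eventually_decreasing_cv (fun k => c * q k + C * Lam k) (C * b) K) as [l2 Hl2].
  { intros k Hk. pose proof (HL k Hk) as H1. pose proof (Hqs k) as H2.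
    apply (Rmult_le_compat_l C) in H1; [|exact HC]. apply (Rmult_le_compat_l c) in H2; lra. }
  { intros k. pose proof (Hb k). pose proof (Hq k). nra. }
  split.
  - apply cv_zero_of_le with (fun k => / c * (Lam k - Lam (S k))).
    + exists K. intros k Hk. split; [apply Hw|]. pose proof (HL k Hk).
      apply Rmult_le_reg_l with c; [exact Hc|]. rewrite <- Rmult_assoc, Rinv_r by lra. lra.
    + replace 0 with (/ c * (l1 - l1)) by ring. apply cv_scal. apply CV_minus; [exact Hl1|].
      intros eps Heps. destruct (Hl1 eps Heps) as [N HN]. exists N. intros; apply HN; lia.
  - set (l := / c * (l2 - C * l1)).
    assert (Hql : Un_cv q l).
    { apply Un_cv_ext with (fun k => / c * (c * q k + C * Lam k - C * Lam k)).
      - intros k. field. lra.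
      - apply cv_scal. apply CV_minus; [exact Hl2|]. apply cv_scal, Hl1. }
    destruct (Req_dec l 0) as [<-|Hne]; [exact Hql|exfalso].
    assert (Hl : 0 < l).
    { destruct (Rle_lt_or_eq_dec 0 l) as [H|H]; [|exact H|congruence].
      apply Rnot_lt_le. intros Hlt. destruct (Hql (- l)) as [N HN]; [lra|].
      specialize (HN N (le_n N)). unfold Rdist in HN. apply Rabs_def2 in HN.
      pose proof (Hq N). lra. }
    destruct (Hql (l / 2)) as [N0 HN0]; [lra|].
    set (N := max K N0).
    (* Past [N], [q] exceeds [l / 2], so each step size is bounded by a decrease of [Lam]; the sum
       telescopes. *)
    assert (Hsum : forall d, l * c / 2 * (sum_f_R0 gam (N + d) - sum_f_R0 gam N)
                             <= C * (Lam (S N) - Lam (S (N + d)))).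
    { induction d as [|d IH]; [rewrite Nat.add_0_r; lra|]. rewrite Nat.add_succ_r.
      change (sum_f_R0 gam (S (N + d))) with (sum_f_R0 gam (N + d) + gam (S (N + d))).
      specialize (HN0 (S (N + d)) ltac:(lia)). unfold Rdist in HN0. apply Rabs_def2 in HN0.
      pose proof (Hgq (S (N + d))) as H1. pose proof (HL (S (N + d)) ltac:(lia)) as H2.
      pose proof (Hg (S (N + d))) as H3.
      apply (Rmult_le_compat_l C) in H2; [|exact HC].
      apply (Rmult_le_compat_l c) in H1; [|lra].
      assert (gam (S (N + d)) * (l / 2) <= gam (S (N + d)) * q (S (N + d)))
        by (apply Rmult_le_compat_l; lra).
      assert (c * (gam (S (N + d)) * (l / 2)) <= c * (gam (S (N + d)) * q (S (N + d))))
        by (apply Rmult_le_compat_l; lra).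
      lra. }
    assert (Hlc : 0 < l * c / 2) by nra.
    destruct (Hinf (sum_f_R0 gam N + C * (Lam (S N) - b) / (l * c / 2))) as [N1 HN1].
    specialize (HN1 (N + N1)%nat ltac:(lia)). specialize (Hsum N1).
    apply (Rmult_lt_compat_l (l * c / 2)) in HN1; [|exact Hlc].
    assert (Hf : l * c / 2 * (C * (Lam (S N) - b) / (l * c / 2)) = C * (Lam (S N) - b))
      by (field; nra).
    pose proof (Hb (S (N + N1))) as Hbb. apply (Rmult_le_compat_l C) in Hbb; [|exact HC]. lra.
Qed.

(** Convexity of the square at the mixture of [r] and [a / (1 - rho)] with weights [rho] and
    [1 - rho]. *)
Lemma square_contraction rho r a :
  0 < rho < 1 -> (rho * r + a) ^ 2 <= rho * r ^ 2 + a ^ 2 / (1 - rho).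
Proof.
  intros Hr.
  assert (Heq : rho * r ^ 2 + a ^ 2 / (1 - rho) - (rho * r + a) ^ 2
                = rho / (1 - rho) * ((1 - rho) * r - a) ^ 2) by (field; lra).
  assert (0 < rho / (1 - rho)) by (apply Rdiv_lt_0_compat; lra).
  pose proof (pow2_ge_0 ((1 - rho) * r - a)). nra.
Qed.

Lemma young_inequality s c a r : 0 < s -> c * a * r <= s / 2 * r ^ 2 + c ^ 2 / (2 * s) * a ^ 2.
Proof.
  intros Hs.
  assert (Heq : s / 2 * r ^ 2 + c ^ 2 / (2 * s) * a ^ 2 - c * a * r
                = / (2 * s) * (s * r - c * a) ^ 2) by (field; lra).
  assert (0 < / (2 * s)) by (apply Rinv_0_lt_compat; lra).
  pose proof (pow2_ge_0 (s * r - c * a)). nra.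
Qed.

(** Every perturbation is either a multiple of [rx ^ 2] or [ry ^ 2], absorbed by their contraction,
    or a multiple of [(g * D) ^ 2], absorbed by [g * D ^ 2] when [g] is small. The weight [alpha] is
    independent of [g], so one Lyapunov function serves varying step sizes. *)
Lemma lyapunov_decrease c1 C1 C2 C3 rho :
  0 < c1 -> 0 <= C3 -> 0 < rho < 1 ->
  exists alpha gbar, 0 <= alpha /\ 0 < gbar /\
  forall g D rx ry U U', 0 < g <= gbar ->
    U' <= U - c1 * (g * D ^ 2) + C2 * (g * D) * (rx + ry) + C3 * (g * D) ^ 2 ->
    U' + alpha * (rho * rx + g * D) ^ 2 + (rho * ry + C1 * (rx + g * D)) ^ 2
    <= U + alpha * rx ^ 2 + ry ^ 2
       - Rmin (c1 / 2) ((1 - rho) / 2) * (g * D ^ 2 + rx ^ 2 + ry ^ 2).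
Proof.
  intros Hc1 HC3 Hr. set (s := 1 - rho). assert (Hs : 0 < s) by (unfold s; lra).
  assert (Hsi : 0 < / s) by (apply Rinv_0_lt_compat; lra).
  (* The [ry] recursion injects at most [k1 * rx ^ 2]. With this [alpha] the contraction of
     [alpha * rx ^ 2] gains [(s + k1) * rx ^ 2]: [k1] pays the injection, half of [s] pays the cross
     term, and half of [s] is left. *)
  set (k1 := 2 * C1 ^ 2 / s). set (alpha := 1 + k1 / s).
  assert (Hk1 : 0 <= k1).
  { unfold k1, Rdiv. pose proof (pow2_ge_0 C1). nra. }
  assert (Ha : 1 <= alpha) by (unfold alpha, Rdiv; nra).
  (* All multiples of [(g * D) ^ 2]: the given one, two Young remainders of [C2 ^ 2 / (2 * s)], the
     drives of [rx] and [ry], and 1 for positivity. Below [c1 / (2 * K)] they use at most half of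
     the descent. *)
  set (K := C3 + C2 ^ 2 / s + alpha / s + k1 + 1).
  assert (HK : 1 <= K).
  { unfold K, Rdiv. pose proof (pow2_ge_0 C2). nra. }
  exists alpha, (c1 / (2 * K)). split; [lra|]. split; [apply Rdiv_lt_0_compat; lra|].
  intros g D rx ry U U' Hg HU. set (a := g * D) in *.
  pose proof (square_contraction rho rx a Hr) as H1.
  pose proof (square_contraction rho ry (C1 * (rx + a)) Hr) as H2. fold s in H1, H2.
  assert (H3 : (C1 * (rx + a)) ^ 2 / s <= k1 * (rx ^ 2 + a ^ 2)).
  { assert (Heq : k1 * (rx ^ 2 + a ^ 2) - (C1 * (rx + a)) ^ 2 / s = (C1 * (rx - a)) ^ 2 * / s)
      by (unfold k1; field; lra).
    pose proof (pow2_ge_0 (C1 * (rx - a))). nra. }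
  pose proof (young_inequality s C2 a rx Hs) as H4.
  pose proof (young_inequality s C2 a ry Hs) as H5.
  assert (H6 : K * a ^ 2 <= c1 / 2 * (g * D ^ 2)).
  { assert (HgK : g * K <= c1 / 2).
    { replace (c1 / 2) with (c1 / (2 * K) * K) by (field; lra). apply Rmult_le_compat_r; lra. }
    unfold a. replace (K * (g * D) ^ 2) with (g * K * (g * D ^ 2)) by ring.
    apply Rmult_le_compat_r; [|exact HgK]. pose proof (pow2_ge_0 D). nra. }
  apply (Rmult_le_compat_l alpha) in H1; [|lra].
  assert (H7 : alpha * (rho * rx ^ 2 + a ^ 2 / s)
               = alpha * rx ^ 2 - (s + k1) * rx ^ 2 + alpha / s * a ^ 2)
    by (unfold alpha, s; field; unfold s in Hs; lra).
  assert (H8 : C2 ^ 2 / (2 * s) * a ^ 2 = C2 ^ 2 / s * a ^ 2 / 2) by (field; lra).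
  assert (H9 : rho * ry ^ 2 = ry ^ 2 - s * ry ^ 2) by (unfold s; ring).
  assert (Hsum : U' + alpha * (rho * rx + a) ^ 2 + (rho * ry + C1 * (rx + a)) ^ 2
    <= U + alpha * rx ^ 2 + ry ^ 2 - (c1 / 2 * (g * D ^ 2) + s / 2 * (rx ^ 2 + ry ^ 2))).
  { unfold K in H6. pose proof (pow2_ge_0 a). lra. }
  pose proof (Rmin_l (c1 / 2) (s / 2)). pose proof (Rmin_r (c1 / 2) (s / 2)).
  pose proof (pow2_ge_0 D). pose proof (pow2_ge_0 rx). pose proof (pow2_ge_0 ry).
  assert (0 <= g * D ^ 2) by nra.
  set (mn := Rmin (c1 / 2) (s / 2)) in *.
  assert (mn * (g * D ^ 2) <= c1 / 2 * (g * D ^ 2)) by (apply Rmult_le_compat_r; lra).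
  assert (mn * (rx ^ 2 + ry ^ 2) <= s / 2 * (rx ^ 2 + ry ^ 2)) by (apply Rmult_le_compat_r; lra).
  lra.
Qed.

(** * The SONATA iteration *)

Section Problem.

Variables (m n : nat) (X O : vec -> Prop) (f : nat -> vec -> R) (grad : nat -> vec -> vec).
Variables (G : vec -> R) (A : nat -> nat -> nat -> R).
Variables (ft : nat -> vec -> vec -> R) (gft : nat -> vec -> vec -> vec).
Variables (Lm Ltm tm Vmin : R).

Hypothesis n_pos : (0 < n)%nat.
Hypothesis X_closed : is_closed m X.
Hypothesis X_convex : is_convex X.
Hypothesis O_vec : forall z, O z -> in_Vm m z.
Hypothesis O_open : is_open m O.
Hypothesis X_sub_O : forall z, X z -> O z.
Hypothesis G_convex : convex_fun_on O G.
Hypothesis V_bounded : forall z, X z -> Vmin <= rsum n (fun i => f i z) + G z.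
Hypothesis A_stochastic : forall k, col_stochastic n A k.
Hypothesis Lm_nonneg : 0 <= Lm.
Hypothesis Ltm_nonneg : 0 <= Ltm.
Hypothesis tm_pos : 0 < tm.
Hypothesis f_gradient : forall i, (i < n)%nat -> has_gradient_on m O (f i) (grad i).
Hypothesis grad_lipschitz : forall i, (i < n)%nat -> lipschitz_on m X (grad i) Lm.
Hypothesis ft_strongly_convex : forall i z, (i < n)%nat -> X z ->
  strongly_convex_on m X (fun w => ft i w z) tm.
Hypothesis ft_gradient : forall i z, (i < n)%nat -> X z ->
  has_gradient_on m O (fun w => ft i w z) (fun w => gft i w z).
Hypothesis ft_consistent : forall i z, (i < n)%nat -> X z -> gft i z z = grad i z.
Hypothesis gft_lipschitz : forall i z, (i < n)%nat -> X z ->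
  lipschitz_on m X (fun w => gft i z w) Ltm.

Lemma INR_n_ge_1 : 1 <= INR n.
Proof. change 1 with (INR 1). apply le_INR. lia. Qed.

Lemma G_convex_on_X : convex_fun_on X G.
Proof. intros x y t Hx Hy Ht Hc. apply G_convex; auto. Qed.

Lemma gradF_lipschitz a b :
  X a -> X b ->
  norm m (vsub (gradF n grad a) (gradF n grad b)) <= INR n * Lm * norm m (vsub a b).
Proof.
  intros Ha Hb.
  replace (vsub (gradF n grad a) (gradF n grad b))
    with (vsum n (fun i => vsub (grad i a) (grad i b))).
  - eapply Rle_trans; [apply norm_vsum|]. rewrite Rmult_assoc, <- rsum_const.
    apply rsum_le; intros i Hi. apply grad_lipschitz; assumption.
  - apply functional_extensionality; intro c. unfold gradF, vsub, vsum. apply rsum_minus.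
Qed.

(* The gradient of the surrogate is not assumed Lipschitz in its first argument; gradient
   consistency at [w] lets the Lipschitz bound in the second argument do the work. *)
Lemma surrogate_gradient_dist i w x :
  (i < n)%nat -> X w -> X x ->
  norm m (vsub (gft i w x) (grad i x)) <= (Ltm + Lm) * norm m (vsub w x).
Proof.
  intros Hi Hw Hx. eapply Rle_trans; [apply norm_sub_triangle with (y := gft i w w)|].
  rewrite (ft_consistent i w Hi Hw) at 2.
  pose proof (gft_lipschitz i w Hi Hw x w Hx Hw) as H1. simpl in H1.
  rewrite (norm_sub_comm m x w) in H1.
  pose proof (grad_lipschitz i Hi w x Hw Hx). lra.
Qed.

(** * Optimality of the agents' subproblems and estimates of J *)

Definition subproblem i (x y : vec) : vec -> R := fun z =>
  ft i z x + inner m (vsub (vscal (INR n) y) (grad i x)) (vsub z x) + G z.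

Lemma subproblem_variational i x y w :
  (i < n)%nat -> X x -> is_argmin X (subproblem i x y) w ->
  forall z, X z ->
    0 <= inner m (vadd (gft i w x) (vsub (vscal (INR n) y) (grad i x))) (vsub z w) + G z - G w.
Proof.
  intros Hi Hx Hw. apply (argmin_variational _ _ _ _ _ _ X_convex G_convex_on_X Hw).
  intros eps Heps. destruct (ft_gradient i x Hi Hx w (X_sub_O w (proj1 Hw))) as [_ Hd].
  destruct (Hd eps Heps) as [delta [Hdel Hd']]. exists delta. split; [exact Hdel|].
  intros z Hz Hzd. specialize (Hd' z (X_sub_O z Hz) Hzd). apply Rabs_bounds in Hd'.
  unfold subproblem. replace (vsub z x) with (vadd (vsub z w) (vsub w x)) by vec_ring.
  rewrite inner_add_l, inner_add_r. lra.
Qed.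

(** The variational inequality at [x] is added to strong monotonicity of the surrogate gradient.
    Consistency at [x] cancels [grad i x], so that [INR n * y] alone plays the role of the gradient
    of F. *)
Lemma subproblem_descent i x y w :
  (i < n)%nat -> X x -> is_argmin X (subproblem i x y) w ->
  inner m (vscal (INR n) y) (vsub w x) + G w - G x <= - (tm * norm m (vsub w x) ^ 2).
Proof.
  intros Hi Hx Hw. pose proof (subproblem_variational i x y w Hi Hx Hw x Hx) as H1.
  pose proof (strongly_monotone_gradient m X O _ _ tm x w X_convex X_sub_O
    (ft_strongly_convex i x Hi Hx) (Rlt_le _ _ tm_pos) (ft_gradient i x Hi Hx) Hx (proj1 Hw)) as H2.
  simpl in H2. rewrite (ft_consistent i x Hi Hx) in H2.
  replace (vsub x w) with (vscal (-1) (vsub w x)) in H1 by vec_ring.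
  rewrite inner_scal_r, inner_add_l, inner_sub_l in H1. rewrite inner_sub_l in H2. lra.
Qed.

Lemma prox_pt_is_argmin c a :
  X a ->
  is_argmin X (fun w => inner m c (vsub w a) + / 2 * norm m (vsub w a) ^ 2 + G w)
    (prox_pt m X G c a).
Proof.
  intros Ha. unfold prox_pt. apply epsilon_spec.
  apply prox_exists with O; assumption.
Qed.

(** [prox_dist] compares the two proximal points: the gradients contribute [INR n * Lm] and the
    centres 1; moving the base point contributes another 1. This transports J from one step to the
    next and from [xphi] to [xbar]. *)
Lemma Jmerit_lipschitz a b :
  X a -> X b ->
  Jmerit m n X G grad a <= Jmerit m n X G grad b + (INR n * Lm + 2) * norm m (vsub a b).
Proof.
  intros Ha Hb. unfold Jmerit.
  set (p := prox_pt m X G (gradF n grad a) a). set (q := prox_pt m X G (gradF n grad b) b).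
  pose proof (prox_pt_is_argmin (gradF n grad a) a Ha) as Hp. fold p in Hp.
  pose proof (prox_pt_is_argmin (gradF n grad b) b Hb) as Hq. fold q in Hq.
  pose proof (prox_dist m X G _ a p _ q X_convex G_convex_on_X Hp (proj1 Hq)
    (prox_variational m X G _ b q X_convex G_convex_on_X Hq)) as Hd.
  replace (vsub (vsub (vadd (gradF n grad b) (vsub q b)) (gradF n grad a)) (vsub q a))
    with (vadd (vsub (gradF n grad b) (gradF n grad a)) (vsub a b)) in Hd by vec_ring.
  pose proof (norm_add m (vsub (gradF n grad b) (gradF n grad a)) (vsub a b)).
  pose proof (gradF_lipschitz b a Hb Ha) as Hl. rewrite (norm_sub_comm m b a) in Hl.
  pose proof (norm_sub_triangle m a b p). pose proof (norm_sub_triangle m b q p).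
  rewrite (norm_sub_comm m p q) in Hd. lra.
Qed.

(** The subproblem solution [w] is an approximate proximal point at [z]. Its defect consists of the
    surrogate mismatch, the gradient tracking error and the displacement between [x] and [z]. *)
Lemma Jmerit_bound i z x y w :
  (i < n)%nat -> X z -> X x -> is_argmin X (subproblem i x y) w ->
  Jmerit m n X G grad z <=
    (Ltm + Lm + 2) * norm m (vsub w x) + 2 * norm m (vsub x z)
    + norm m (vsub (vscal (INR n) y) (gradF n grad z)).
Proof.
  intros Hi Hz Hx Hw. unfold Jmerit. set (p := prox_pt m X G (gradF n grad z) z).
  pose proof (prox_pt_is_argmin (gradF n grad z) z Hz) as Hp. fold p in Hp.
  pose proof (prox_dist m X G _ z p _ w X_convex G_convex_on_X Hp (proj1 Hw)
    (subproblem_variational i x y w Hi Hx Hw)) as Hd.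
  set (u := vsub (vscal (INR n) y) (gradF n grad z)).
  replace (vsub (vsub (vadd (gft i w x) (vsub (vscal (INR n) y) (grad i x))) (gradF n grad z))
             (vsub w z))
    with (vadd (vadd (vsub (gft i w x) (grad i x)) u) (vsub z w)) in Hd
    by (unfold u; vec_ring).
  pose proof (norm_add m (vadd (vsub (gft i w x) (grad i x)) u) (vsub z w)).
  pose proof (norm_add m (vsub (gft i w x) (grad i x)) u).
  pose proof (surrogate_gradient_dist i w x Hi (proj1 Hw) Hx).
  pose proof (norm_sub_triangle m z w p). pose proof (norm_sub_triangle m z x w).
  rewrite (norm_sub_comm m z x), (norm_sub_comm m x w) in *.
  rewrite (norm_sub_comm m p w) in Hd. lra.
Qed.

(** * A single run, with the consensus constants fixed beforehand *)

Section Run.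

Variables (rho C lb : R) (gamma : nat -> R) (x xt xh : nat -> nat -> vec).
Variables (phi : nat -> nat -> R) (y : nat -> nat -> vec).

Hypothesis rho_range : 0 < rho < 1.
Hypothesis C_pos : 0 < C.
Hypothesis lb_pos : 0 < lb.
Hypothesis gamma_range : forall k, 0 < gamma k <= 1.
Hypothesis phi_bounds : forall k i, (i < n)%nat -> lb <= phi k i <= INR n.
Hypothesis consensus : forall (z : nat -> nat -> R) (e r : nat -> R),
  (forall k, 0 <= e k) ->
  (forall k i, (i < n)%nat ->
     Rabs (phi (S k) i * z (S k) i - rsum n (fun j => A k i j * phi k j * z k j))
     <= phi (S k) i * e k) ->
  (forall k, r (S k) = rho * r k + e k) ->
  (forall i j, (i < n)%nat -> (j < n)%nat -> Rabs (z 0%nat i - z 0%nat j) <= r 0%nat) ->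
  forall k i j, (i < n)%nat -> (j < n)%nat -> Rabs (z k i - z k j) <= C * r k.
Hypothesis run : sonata m n X G grad ft gamma A x xt xh phi y.

Lemma phi_pos k i : (i < n)%nat -> 0 < phi k i.
Proof. intros Hi. pose proof (phi_bounds k i Hi). lra. Qed.

Lemma phi_rec k i : (i < n)%nat -> phi (S k) i = rsum n (fun j => A k i j * phi k j).
Proof. intros Hi. apply (proj2 run k i Hi). Qed.

Lemma phi_sum k : rsum n (phi k) = INR n.
Proof.
  apply weights_sum with A; [exact A_stochastic| |exact phi_rec].
  intros i Hi. apply (proj1 run i Hi).
Qed.

Lemma xt_argmin k i : (i < n)%nat -> is_argmin X (subproblem i (x k i) (y k i)) (xt k i).
Proof. intros Hi. apply (proj2 run k i Hi). Qed.

Lemma xh_eq k i : (i < n)%nat -> xh k i = comb (gamma k) (xt k i) (x k i).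
Proof. intros Hi. destruct (proj2 run k i Hi) as [_ [-> _]]. vec_ring. Qed.

Lemma mixing_nonneg k i j : (i < n)%nat -> (j < n)%nat -> 0 <= A k i j * phi k j.
Proof.
  intros Hi Hj. apply Rmult_le_pos; [apply A_stochastic; assumption|apply Rlt_le, phi_pos, Hj].
Qed.

Lemma column_sum k (h : nat -> R) :
  rsum n (fun i => rsum n (fun j => A k i j * phi k j * h j)) = rsum n (fun j => phi k j * h j).
Proof.
  rewrite rsum_swap. apply rsum_ext; intros j Hj.
  rewrite (rsum_ext n _ (fun i => phi k j * h j * A k i j)), rsum_scal by (intros; ring).
  rewrite (proj2 (A_stochastic k) j Hj). ring.
Qed.

Lemma x_rec_coord k i c :
  (i < n)%nat -> phi (S k) i * x (S k) i c = rsum n (fun j => A k i j * phi k j * xh k j c).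
Proof.
  intros Hi. destruct (proj2 run k i Hi) as [_ [_ [_ [-> _]]]].
  unfold vscal at 1. rewrite <- Rmult_assoc, Rinv_r, Rmult_1_l; [reflexivity|].
  pose proof (phi_pos (S k) i Hi). lra.
Qed.

Lemma y_rec_coord k i c :
  (i < n)%nat ->
  phi (S k) i * y (S k) i c
  = rsum n (fun j => A k i j * phi k j * y k j c) + (grad i (x (S k) i) c - grad i (x k i) c).
Proof.
  intros Hi. destruct (proj2 run k i Hi) as [_ [_ [_ [_ ->]]]].
  unfold vadd, vscal at 1 3. unfold vsub, vsum, vscal. field.
  pose proof (phi_pos (S k) i Hi). lra.
Qed.

(** Jensen with weights [A k i j * phi k j]. Feasibility of [xh] is a premise because [x_feasible]
    supplies it from its own induction hypothesis. *)
Lemma mixing_step k i :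
  (i < n)%nat -> (forall j, (j < n)%nat -> X (xh k j)) ->
  X (x (S k) i) /\
  phi (S k) i * G (x (S k) i) <= rsum n (fun j => A k i j * phi k j * G (xh k j)).
Proof.
  intros Hi Hh. pose proof (phi_pos (S k) i Hi) as Hp.
  destruct (jensen X G n (fun j => A k i j * phi k j) (xh k) X_convex G_convex_on_X) as [H1 H2].
  - intros j Hj. apply mixing_nonneg; assumption.
  - exact Hh.
  - rewrite <- phi_rec; assumption.
  - rewrite <- phi_rec in H1, H2 by exact Hi.
    destruct (proj2 run k i Hi) as [_ [_ [_ [Hx _]]]]. rewrite Hx.
    split; [exact H1|]. apply (Rmult_le_compat_l (phi (S k) i)) in H2; [|lra].
    rewrite <- Rmult_assoc, Rinv_r, Rmult_1_l in H2 by lra. exact H2.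
Qed.

Lemma xh_feasible_of k i : (i < n)%nat -> X (x k i) -> X (xh k i).
Proof.
  intros Hi Hx. rewrite xh_eq by exact Hi. pose proof (gamma_range k).
  apply X_convex; [apply xt_argmin, Hi|exact Hx|lra].
Qed.

Lemma x_feasible k i : (i < n)%nat -> X (x k i).
Proof.
  revert i. induction k as [|k IH]; intros i Hi; [apply (proj1 run i Hi)|].
  apply mixing_step; [exact Hi|]. intros j Hj. apply xh_feasible_of; auto.
Qed.

Lemma xh_feasible k i : (i < n)%nat -> X (xh k i).
Proof. intros Hi. apply xh_feasible_of, x_feasible; exact Hi. Qed.

(** * Search directions and disagreement of the agents *)

Definition dir k i : vec := vsub (xt k i) (x k i).
Definition dir_norm k : R := sqrt (rsum n (fun i => norm m (dir k i) ^ 2)).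

Lemma dir_norm_nonneg k : 0 <= dir_norm k.
Proof. apply sqrt_pos. Qed.

Lemma dir_norm_sqr k : dir_norm k ^ 2 = rsum n (fun i => norm m (dir k i) ^ 2).
Proof. apply pow2_sqrt, rsum_nonneg. intros. apply pow2_ge_0. Qed.

Lemma dir_le_dir_norm k i : (i < n)%nat -> norm m (dir k i) <= dir_norm k.
Proof.
  intros Hi. apply Rsqr_incr_0_var; [|apply dir_norm_nonneg]. rewrite !Rsqr_pow2, dir_norm_sqr.
  apply (rsum_term_le n (fun i => norm m (dir k i) ^ 2)); [intros; apply pow2_ge_0|exact Hi].
Qed.

Lemma gamma_dir_norm_nonneg k : 0 <= gamma k * dir_norm k.
Proof. pose proof (gamma_range k). pose proof (dir_norm_nonneg k). nra. Qed.

Lemma xh_coord_dev k j c :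
  (j < n)%nat -> (c < m)%nat -> Rabs (xh k j c - x k j c) <= gamma k * dir_norm k.
Proof.
  intros Hj Hc. rewrite xh_eq by exact Hj.
  replace (comb (gamma k) (xt k j) (x k j) c - x k j c) with (gamma k * dir k j c)
    by (unfold comb, dir, vadd, vsub, vscal; ring).
  pose proof (gamma_range k). rewrite Rabs_mult, Rabs_pos_eq by lra.
  apply Rmult_le_compat_l; [lra|].
  eapply Rle_trans; [apply coord_le_norm, Hc|apply dir_le_dir_norm, Hj].
Qed.

(** The Lipschitz constant times the factor of [x_step] bounds the change of a local gradient; the
    division by [lb] expresses it relative to [phi], as [consensus] requires. *)
Definition grad_drift_const : R := Lm * (INR m * (C + 1)) / lb.

(* Majorants of the disagreement of the [x] and [y] variables. *)
Fixpoint rx k : R :=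
  match k with
  | 0%nat => 2 * rsum n (fun i => norm m (x 0%nat i))
  | S k' => rho * rx k' + gamma k' * dir_norm k'
  end.
Fixpoint ry k : R :=
  match k with
  | 0%nat => 2 * rsum n (fun i => norm m (y 0%nat i))
  | S k' => rho * ry k' + grad_drift_const * (rx k' + gamma k' * dir_norm k')
  end.

Lemma grad_drift_const_nonneg : 0 <= grad_drift_const.
Proof.
  apply Rle_mult_inv_pos; [|exact lb_pos]. pose proof (pos_INR m).
  apply Rmult_le_pos; [exact Lm_nonneg|nra].
Qed.

Lemma rx_nonneg k : 0 <= rx k.
Proof.
  induction k as [|k IH]; simpl.
  - assert (0 <= rsum n (fun i => norm m (x 0%nat i)))
      by (apply rsum_nonneg; intros; apply norm_nonneg). lra.
  - pose proof (gamma_dir_norm_nonneg k). nra.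
Qed.

Lemma ry_nonneg k : 0 <= ry k.
Proof.
  induction k as [|k IH]; simpl.
  - assert (0 <= rsum n (fun i => norm m (y 0%nat i)))
      by (apply rsum_nonneg; intros; apply norm_nonneg). lra.
  - pose proof (gamma_dir_norm_nonneg k). pose proof (rx_nonneg k).
    pose proof grad_drift_const_nonneg.
    nra.
Qed.

Lemma initial_spread (u : nat -> vec) i j c :
  (i < n)%nat -> (j < n)%nat -> (c < m)%nat ->
  Rabs (u i c - u j c) <= 2 * rsum n (fun i => norm m (u i)).
Proof.
  intros Hi Hj Hc.
  assert (Hb : forall l, (l < n)%nat -> Rabs (u l c) <= rsum n (fun i => norm m (u i))).
  { intros l Hl. eapply Rle_trans; [apply coord_le_norm, Hc|].
    apply (rsum_term_le n (fun i => norm m (u i))); [intros; apply norm_nonneg|exact Hl]. }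
  pose proof (Hb i Hi) as H1. pose proof (Hb j Hj) as H2.
  apply Rabs_bounds in H1. apply Rabs_bounds in H2. apply Rabs_le. lra.
Qed.

Lemma x_consensus k i j c :
  (i < n)%nat -> (j < n)%nat -> (c < m)%nat -> Rabs (x k i c - x k j c) <= C * rx k.
Proof.
  intros Hi Hj Hc. revert k i j Hi Hj.
  apply (consensus (fun k i => x k i c) (fun k => gamma k * dir_norm k) rx).
  - exact gamma_dir_norm_nonneg.
  - intros k i Hi. rewrite x_rec_coord, phi_rec, <- rsum_minus by exact Hi.
    eapply Rle_trans; [apply rsum_abs|]. rewrite Rmult_comm, <- rsum_scal.
    apply rsum_le; intros j Hj. rewrite <- Rmult_minus_distr_l, Rabs_mult.
    pose proof (mixing_nonneg k i j Hi Hj). rewrite (Rabs_pos_eq (A k i j * phi k j)) by assumption.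
    rewrite Rmult_comm. apply Rmult_le_compat_r; [assumption|].
    apply xh_coord_dev; assumption.
  - reflexivity.
  - intros i j Hi Hj. apply initial_spread; assumption.
Qed.

(** The new iterate is a convex average of the [xh k j], each within
    [C * rx k + gamma k * dir_norm k] of [x k i] in every coordinate; [INR m] passes from
    coordinates to the norm. *)
Lemma x_step k i :
  (i < n)%nat ->
  norm m (vsub (x (S k) i) (x k i)) <= INR m * (C + 1) * (rx k + gamma k * dir_norm k).
Proof.
  intros Hi. pose proof (rx_nonneg k) as Hr. pose proof (gamma_dir_norm_nonneg k) as Hg.
  pose proof (phi_pos (S k) i Hi) as Hp.
  rewrite Rmult_assoc. apply norm_le_coords; [nra|]. intros c Hc. unfold vsub.
  replace (x (S k) i c) with (rsum n (fun j => A k i j * phi k j / phi (S k) i * xh k j c)).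
  - apply convex_comb_dev.
    + intros j Hj. apply Rle_mult_inv_pos; [apply mixing_nonneg; assumption|exact Hp].
    + unfold Rdiv. rewrite (rsum_ext n _ (fun j => / phi (S k) i * (A k i j * phi k j)))
        by (intros; ring).
      rewrite rsum_scal, <- phi_rec by exact Hi. apply Rinv_l. lra.
    + intros j Hj. pose proof (x_consensus k j i c Hj Hi Hc) as H1.
      pose proof (xh_coord_dev k j c Hj Hc) as H2.
      apply Rabs_bounds in H1. apply Rabs_bounds in H2. apply Rabs_le. nra.
  - apply Rmult_eq_reg_l with (phi (S k) i); [|lra]. rewrite x_rec_coord, <- rsum_scal by exact Hi.
    apply rsum_ext; intros j Hj. field. lra.
Qed.

Lemma y_consensus k i j c :
  (i < n)%nat -> (j < n)%nat -> (c < m)%nat -> Rabs (y k i c - y k j c) <= C * ry k.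
Proof.
  intros Hi Hj Hc. revert k i j Hi Hj.
  apply (consensus (fun k i => y k i c)
           (fun k => grad_drift_const * (rx k + gamma k * dir_norm k)) ry).
  - intros k. pose proof (rx_nonneg k). pose proof (gamma_dir_norm_nonneg k).
    pose proof grad_drift_const_nonneg. nra.
  - intros k i Hi. rewrite y_rec_coord by exact Hi.
    match goal with |- Rabs (?a + ?b - ?a) <= _ => replace (a + b - a) with b by ring end.
    eapply Rle_trans; [apply (coord_le_norm m (vsub (grad i (x (S k) i)) (grad i (x k i)))), Hc|].
    eapply Rle_trans; [apply grad_lipschitz; auto using x_feasible|].
    eapply Rle_trans; [apply Rmult_le_compat_l, x_step; [exact Lm_nonneg|exact Hi]|].
    apply Rle_trans with (lb * (grad_drift_const * (rx k + gamma k * dir_norm k))).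
    + right. unfold grad_drift_const. field. lra.
    + apply Rmult_le_compat_r; [|apply phi_bounds, Hi]. pose proof (rx_nonneg k).
      pose proof (gamma_dir_norm_nonneg k). pose proof grad_drift_const_nonneg. nra.
  - reflexivity.
  - intros i j Hi Hj. apply initial_spread; assumption.
Qed.

(** * The weighted average and gradient tracking *)

Definition xphi k : vec := vscal (/ INR n) (vsum n (fun i => vscal (phi k i) (x k i))).

Lemma xphi_feasible_jensen k :
  X (xphi k) /\ G (xphi k) <= / INR n * rsum n (fun i => phi k i * G (x k i)).
Proof.
  unfold xphi. rewrite <- (phi_sum k). apply jensen.
  - exact X_convex.
  - exact G_convex_on_X.
  - intros i Hi. apply Rlt_le, phi_pos, Hi.
  - intros i Hi. apply x_feasible, Hi.
  - rewrite phi_sum. pose proof INR_n_ge_1. lra.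
Qed.

Lemma phi_average_dev k (z : nat -> R) w b :
  (forall i, (i < n)%nat -> Rabs (z i - w) <= b) ->
  Rabs (/ INR n * rsum n (fun i => phi k i * z i) - w) <= b.
Proof.
  intros Hz. pose proof INR_n_ge_1 as Hn. rewrite <- rsum_scal.
  rewrite (rsum_ext n _ (fun i => phi k i / INR n * z i)) by (intros; field; lra).
  apply convex_comb_dev; [| |exact Hz].
  - intros i Hi. apply Rle_mult_inv_pos; [apply Rlt_le, phi_pos, Hi|lra].
  - unfold Rdiv. rewrite (rsum_ext n _ (fun i => / INR n * phi k i)) by (intros; ring).
    rewrite rsum_scal, phi_sum. apply Rinv_l. lra.
Qed.

Lemma x_xphi_coord k i c :
  (i < n)%nat -> (c < m)%nat -> Rabs (x k i c - xphi k c) <= C * rx k.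
Proof.
  intros Hi Hc. rewrite Rabs_minus_sym.
  apply (phi_average_dev k (fun j => x k j c)). intros j Hj. apply x_consensus; assumption.
Qed.

Lemma C_rx_nonneg k : 0 <= C * rx k.
Proof. pose proof (rx_nonneg k). nra. Qed.

Lemma C_ry_nonneg k : 0 <= C * ry k.
Proof. pose proof (ry_nonneg k). nra. Qed.

Lemma x_xphi_dist k i : (i < n)%nat -> norm m (vsub (x k i) (xphi k)) <= INR m * (C * rx k).
Proof.
  intros Hi. apply norm_le_coords; [apply C_rx_nonneg|].
  intros c Hc. apply x_xphi_coord; assumption.
Qed.

Lemma xbar_coord k c : xbar n x k c = rsum n (fun j => / INR n * x k j c).
Proof. unfold xbar, vscal, vsum. now rewrite <- rsum_scal. Qed.

Lemma average_dev (z : nat -> R) w b :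
  (forall i, (i < n)%nat -> Rabs (z i - w) <= b) ->
  Rabs (rsum n (fun j => / INR n * z j) - w) <= b.
Proof.
  intros Hz. pose proof INR_n_ge_1 as Hn. apply convex_comb_dev; [| |exact Hz].
  - intros i Hi. apply Rlt_le, Rinv_0_lt_compat. lra.
  - rewrite rsum_const. apply Rinv_r. lra.
Qed.

Lemma xbar_xphi_dist k : norm m (vsub (xbar n x k) (xphi k)) <= INR m * (C * rx k).
Proof.
  apply norm_le_coords; [apply C_rx_nonneg|]. intros c Hc. unfold vsub. rewrite xbar_coord.
  apply average_dev. intros i Hi. apply x_xphi_coord; assumption.
Qed.

Lemma x_xbar_dist k i : (i < n)%nat -> norm m (vsub (x k i) (xbar n x k)) <= INR m * (C * rx k).
Proof.
  intros Hi. apply norm_le_coords; [apply C_rx_nonneg|]. intros c Hc. unfold vsub.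
  rewrite xbar_coord, Rabs_minus_sym. apply average_dev. intros j Hj.
  apply x_consensus; assumption.
Qed.

Lemma xbar_feasible k : X (xbar n x k).
Proof.
  pose proof INR_n_ge_1 as Hn.
  destruct (jensen X G n (fun _ => 1) (x k) X_convex G_convex_on_X) as [H _].
  - intros; lra.
  - intros; apply x_feasible; assumption.
  - rewrite rsum_const. lra.
  - rewrite rsum_const, Rmult_1_r in H. unfold xbar.
    replace (vsum n (fun i => x k i)) with (vsum n (fun i => vscal 1 (x k i))); [exact H|].
    apply functional_extensionality; intro c. apply rsum_ext; intros. unfold vscal. ring.
Qed.

Definition dphi k : vec := vsum n (fun i => vscal (phi k i / INR n) (dir k i)).

Lemma xphi_step k : vsub (xphi (S k)) (xphi k) = vscal (gamma k) (dphi k).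
Proof.
  pose proof INR_n_ge_1 as Hn. apply functional_extensionality; intro c.
  unfold xphi, dphi, vsub, vscal, vsum.
  rewrite (rsum_ext n (fun i => phi (S k) i * x (S k) i c) _ (fun i => x_rec_coord k i c)).
  rewrite column_sum, <- !rsum_scal, <- rsum_minus. apply rsum_ext; intros i Hi.
  rewrite xh_eq by exact Hi. unfold comb, dir, vadd, vsub, vscal. field. lra.
Qed.

Lemma dphi_le_dir_norm k : norm m (dphi k) <= dir_norm k.
Proof.
  pose proof INR_n_ge_1 as Hn. eapply Rle_trans; [apply norm_vsum|].
  apply Rle_trans with (rsum n (fun i => dir_norm k / INR n * phi k i)).
  - apply rsum_le; intros i Hi. pose proof (phi_pos k i Hi).
    assert (Hq : 0 <= phi k i / INR n) by (apply Rle_mult_inv_pos; lra).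
    rewrite norm_scal, Rabs_pos_eq by exact Hq.
    replace (dir_norm k / INR n * phi k i) with (phi k i / INR n * dir_norm k) by (field; lra).
    apply Rmult_le_compat_l; [exact Hq|apply dir_le_dir_norm, Hi].
  - rewrite rsum_scal, phi_sum. right. field. lra.
Qed.

Lemma tracking_conservation k c :
  rsum n (fun i => phi k i * y k i c) = rsum n (fun i => grad i (x k i) c).
Proof.
  induction k as [|k IH].
  - apply rsum_ext; intros i Hi. destruct (proj1 run i Hi) as [_ [-> ->]]. ring.
  - rewrite (rsum_ext n _ _ (fun i => y_rec_coord k i c)).
    rewrite rsum_plus, column_sum, IH, rsum_minus. ring.
Qed.

(** The error bound has the factor [INR n * (INR m * C)] on [ry] and [Lm] times it on [rx]; [Lm + 1]
    dominates both. *)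
Definition tracking_const : R := INR n * (INR m * C) * (Lm + 1).

Lemma tracking_error k i :
  (i < n)%nat ->
  norm m (vsub (vscal (INR n) (y k i)) (gradF n grad (xphi k))) <= tracking_const * (rx k + ry k).
Proof.
  intros Hi. pose proof INR_n_ge_1 as Hn. pose proof (pos_INR m) as Hm.
  (* The pivot is the sum of local gradients at the agents' own points: by conservation it is the
     weighted sum of the [y k j], so consensus of [y] handles one side and consensus of [x] the
     other. *)
  set (g := vsum n (fun j => grad j (x k j))).
  eapply Rle_trans; [apply norm_sub_triangle with (y := g)|].
  assert (H1 : norm m (vsub (vscal (INR n) (y k i)) g) <= INR m * (INR n * (C * ry k))).
  { apply norm_le_coords; [pose proof (C_ry_nonneg k); nra|]. intros c Hc.
    unfold g, vsub, vscal, vsum. rewrite <- tracking_conservation.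
    pose proof (phi_average_dev k (fun j => y k j c) (y k i c) (C * ry k)) as Hd.
    rewrite Rabs_minus_sym in Hd.
    replace (INR n * y k i c - rsum n (fun j => phi k j * y k j c))
      with (INR n * (y k i c - / INR n * rsum n (fun j => phi k j * y k j c))) by (field; lra).
    rewrite Rabs_mult, Rabs_pos_eq by lra. apply Rmult_le_compat_l; [lra|]. apply Hd.
    intros j Hj. apply y_consensus; assumption. }
  assert (H2 : norm m (vsub g (gradF n grad (xphi k))) <= INR n * (Lm * (INR m * (C * rx k)))).
  { replace (vsub g (gradF n grad (xphi k)))
      with (vsum n (fun j => vsub (grad j (x k j)) (grad j (xphi k)))).
    - eapply Rle_trans; [apply norm_vsum|]. rewrite <- rsum_const. apply rsum_le; intros j Hj.
      eapply Rle_trans; [apply grad_lipschitz;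
        [exact Hj|apply x_feasible, Hj|apply xphi_feasible_jensen]|].
      apply Rmult_le_compat_l; [exact Lm_nonneg|apply x_xphi_dist, Hj].
    - apply functional_extensionality; intro c. unfold g, gradF, vsub, vsum. apply rsum_minus. }
  unfold tracking_const. pose proof (rx_nonneg k). pose proof (ry_nonneg k).
  assert (Hk : 0 <= INR n * (INR m * C)) by (apply Rmult_le_pos; nra).
  assert (0 <= INR n * (INR m * C) * rx k) by nra.
  assert (0 <= INR n * (INR m * C) * Lm * ry k).
  { apply Rmult_le_pos; [|assumption]. apply Rmult_le_pos; assumption. }
  lra.
Qed.

Lemma tracking_const_nonneg : 0 <= tracking_const.
Proof.
  unfold tracking_const. pose proof INR_n_ge_1. pose proof (pos_INR m).
  apply Rmult_le_pos; [apply Rmult_le_pos; nra|lra].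
Qed.

(** [G] is averaged over the agents instead of evaluated at [xphi]: no modulus of continuity is
    available to compare the two, while the average is lowered by mixing and dominates [G (xphi k)]
    by Jensen, which keeps the potential bounded below. *)
Definition potential k : R :=
  rsum n (fun i => f i (xphi k)) + / INR n * rsum n (fun i => phi k i * G (x k i)).

Lemma potential_bounded_below k : Vmin <= potential k.
Proof.
  destruct (xphi_feasible_jensen k) as [HX HJ]. pose proof (V_bounded _ HX). unfold potential. lra.
Qed.

Lemma smooth_part_step k :
  rsum n (fun i => f i (xphi (S k))) <=
  rsum n (fun i => f i (xphi k)) + gamma k * inner m (gradF n grad (xphi k)) (dphi k)
  + INR n * Lm * (gamma k * dir_norm k) ^ 2.
Proof.
  pose proof (gamma_range k) as Hg. pose proof (dphi_le_dir_norm k).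
  pose proof (norm_nonneg m (dphi k)).
  apply Rle_trans with (rsum n (fun i => f i (xphi k)
    + (gamma k * inner m (grad i (xphi k)) (dphi k) + Lm * (gamma k * dir_norm k) ^ 2))).
  - apply rsum_le; intros i Hi.
    pose proof (descent_lemma m X O (f i) (grad i) Lm (xphi k) (xphi (S k)) X_convex O_open O_vec
      X_sub_O (f_gradient i Hi) (grad_lipschitz i Hi) (proj1 (xphi_feasible_jensen k))
      (proj1 (xphi_feasible_jensen (S k)))) as Hd.
    rewrite xphi_step, inner_scal_r, norm_scal in Hd.
    rewrite (Rabs_pos_eq (gamma k)), (Rabs_pos_eq Lm) in Hd by lra.
    assert ((gamma k * norm m (dphi k)) ^ 2 <= (gamma k * dir_norm k) ^ 2).
    { apply pow_incr. split; [nra|]. apply Rmult_le_compat_l; lra. }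
    nra.
  - rewrite !rsum_plus, rsum_scal, rsum_const. unfold gradF. rewrite inner_vsum_l. lra.
Qed.

(** Mixing cannot raise the weighted average of [G], and convexity along the segment from [x] to
    [xt] bounds the effect of the local step. *)
Lemma nonsmooth_part_step k :
  rsum n (fun i => phi (S k) i * G (x (S k) i)) <=
  rsum n (fun i => phi k i * G (x k i))
  + gamma k * rsum n (fun i => phi k i * (G (xt k i) - G (x k i))).
Proof.
  apply Rle_trans with (rsum n (fun i => phi k i * G (xh k i))).
  - rewrite <- (column_sum k (fun j => G (xh k j))). apply rsum_le; intros i Hi.
    apply mixing_step; [exact Hi|].
    intros; apply xh_feasible; assumption.
  - rewrite <- rsum_scal, <- rsum_plus. apply rsum_le; intros i Hi.
    pose proof (phi_pos k i Hi). pose proof (gamma_range k).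
    pose proof (xh_feasible k i Hi) as Hh. rewrite xh_eq in Hh |- * by exact Hi.
    pose proof (G_convex_on_X (xt k i) (x k i) (gamma k) (proj1 (xt_argmin k i Hi))
      (x_feasible k i Hi) ltac:(lra) Hh) as HG.
    apply (Rmult_le_compat_l (phi k i)) in HG; lra.
Qed.

Lemma potential_descent k :
  potential (S k) <= potential k - lb * tm / INR n * (gamma k * dir_norm k ^ 2)
             + tracking_const * (gamma k * dir_norm k) * (rx k + ry k)
             + INR n * Lm * (gamma k * dir_norm k) ^ 2.
Proof.
  pose proof INR_n_ge_1 as Hn. pose proof (gamma_range k) as Hg.
  pose proof (dir_norm_nonneg k) as HD.
  pose proof (smooth_part_step k) as H1. pose proof (nonsmooth_part_step k) as H2.
  assert (Hin : / INR n > 0) by (apply Rinv_0_lt_compat; lra).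
  set (g := gradF n grad (xphi k)) in *.
  set (E := tracking_const * (rx k + ry k)).
  assert (HE : 0 <= E).
  { unfold E. pose proof (rx_nonneg k). pose proof (ry_nonneg k).
    pose proof tracking_const_nonneg. nra. }
  (* Each agent replaces the gradient at [xphi] by [INR n * y], paying the tracking error [E], and
     then uses its own descent inequality; [lb] bounds the weight on the descent term from below. *)
  assert (Hagent : rsum n (fun i => phi k i * (inner m g (dir k i) + (G (xt k i) - G (x k i))))
                   <= INR n * (E * dir_norm k) - lb * tm * dir_norm k ^ 2).
  { rewrite dir_norm_sqr, <- rsum_scal. rewrite <- (phi_sum k) at 1.
    rewrite (Rmult_comm (rsum n (phi k))), <- rsum_scal, <- rsum_minus.
    apply rsum_le; intros i Hi. pose proof (phi_bounds k i Hi) as Hp.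
    pose proof (subproblem_descent i _ _ _ Hi (x_feasible k i Hi) (xt_argmin k i Hi)) as Hd.
    fold (dir k i) in Hd.
    pose proof (inner_le_norm m (vsub g (vscal (INR n) (y k i))) (dir k i)) as Hcs.
    rewrite inner_sub_l, norm_sub_comm in Hcs.
    pose proof (tracking_error k i Hi) as Ht. fold g in Ht. fold E in Ht.
    pose proof (norm_nonneg m (dir k i)). pose proof (dir_le_dir_norm k i Hi).
    assert (norm m (vsub (vscal (INR n) (y k i)) g) * norm m (dir k i) <= E * dir_norm k).
    { apply Rmult_le_compat; [apply norm_nonneg|assumption|exact Ht|assumption]. }
    assert (Hb : inner m g (dir k i) + (G (xt k i) - G (x k i))
                 <= E * dir_norm k - tm * norm m (dir k i) ^ 2) by lra.
    apply (Rmult_le_compat_l (phi k i)) in Hb; [|lra].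
    assert (lb * (tm * norm m (dir k i) ^ 2) <= phi k i * (tm * norm m (dir k i) ^ 2)).
    { apply Rmult_le_compat_r; [|lra]. apply Rmult_le_pos; [lra|apply pow2_ge_0]. }
    lra. }
  assert (Hsplit : / INR n * rsum n (fun i =>
      phi k i * (inner m g (dir k i) + (G (xt k i) - G (x k i))))
    = inner m g (dphi k) + / INR n * rsum n (fun i => phi k i * (G (xt k i) - G (x k i)))).
  { unfold dphi. rewrite inner_vsum_r, <- !rsum_scal, <- rsum_plus.
    apply rsum_ext; intros i Hi. rewrite inner_scal_r. field. lra. }
  apply (Rmult_le_compat_l (/ INR n)) in Hagent; [|lra]. rewrite Hsplit in Hagent.
  replace (/ INR n * (INR n * (E * dir_norm k) - lb * tm * dir_norm k ^ 2))
    with (E * dir_norm k - lb * tm / INR n * dir_norm k ^ 2) in Hagent by (field; lra).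
  apply (Rmult_le_compat_l (gamma k)) in Hagent; [|lra].
  apply (Rmult_le_compat_l (/ INR n)) in H2; [|lra].
  unfold potential, E in *. lra.
Qed.

(** * Controlling the merit function by the decrement *)

Definition decrement k : R := gamma k * dir_norm k ^ 2 + rx k ^ 2 + ry k ^ 2.
Definition avg_merit k : R := Jmerit m n X G grad (xphi k) ^ 2.
Definition merit_const : R := Ltm + Lm + 2 + 2 * (INR m * C) + tracking_const.

Lemma Jmerit_xphi_bound k :
  Jmerit m n X G grad (xphi k) <= merit_const * (dir_norm k + rx k + ry k).
Proof.
  (* One agent's subproblem suffices to bound J at [xphi]; agent 0 exists by [n_pos]. *)
  pose proof (Jmerit_bound 0 (xphi k) _ _ _ n_pos (proj1 (xphi_feasible_jensen k))
    (x_feasible k 0 n_pos) (xt_argmin k 0 n_pos)) as HJ.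
  fold (dir k 0) in HJ.
  pose proof (dir_le_dir_norm k 0 n_pos). pose proof (x_xphi_dist k 0 n_pos).
  pose proof (tracking_error k 0 n_pos). pose proof (dir_norm_nonneg k). pose proof (rx_nonneg k).
  pose proof (ry_nonneg k). pose proof tracking_const_nonneg. pose proof (pos_INR m).
  set (T := tracking_const) in *. unfold merit_const. fold T.
  assert (0 <= INR m * C) by nra.
  assert ((Ltm + Lm + 2) * norm m (dir k 0) <= (Ltm + Lm + 2) * dir_norm k)
    by (apply Rmult_le_compat_l; lra).
  assert (0 <= (Ltm + Lm + 2) * (rx k + ry k)) by (apply Rmult_le_pos; lra).
  assert (0 <= INR m * C * (dir_norm k + ry k)) by (apply Rmult_le_pos; lra).
  assert (0 <= T * dir_norm k) by (apply Rmult_le_pos; lra).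
  lra.
Qed.

Lemma merit_const_nonneg : 0 <= merit_const.
Proof.
  unfold merit_const. pose proof tracking_const_nonneg. pose proof (pos_INR m).
  assert (0 <= INR m * C) by nra. lra.
Qed.

Definition step_const : R := INR n * Lm + 2.

Lemma step_const_nonneg : 0 <= step_const.
Proof. unfold step_const. pose proof INR_n_ge_1. nra. Qed.

Lemma Jmerit_xphi_step k :
  Jmerit m n X G grad (xphi (S k))
  <= Jmerit m n X G grad (xphi k) + step_const * (gamma k * dir_norm k).
Proof.
  eapply Rle_trans; [apply Jmerit_lipschitz with (b := xphi k); apply xphi_feasible_jensen|].
  apply Rplus_le_compat_l, Rmult_le_compat_l; [apply step_const_nonneg|].
  pose proof (gamma_range k). rewrite xphi_step, norm_scal, Rabs_pos_eq by lra.
  apply Rmult_le_compat_l; [lra|apply dphi_le_dir_norm].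
Qed.

(** The first two terms serve [avg_merit_step], the third [gamma_avg_merit_bound]; [merit_vanishes]
    takes one constant for both. *)
Definition merit_growth : R :=
  4 * merit_const * step_const + step_const ^ 2 + 3 * merit_const ^ 2.

(** The direction norm is controlled only together with a factor [gamma k], so every product
    involving it must carry one; for the disagreements [gamma k <= 1] discards the factor. *)
Lemma decrement_dominates k :
  0 <= decrement k /\ (gamma k * dir_norm k) ^ 2 <= decrement k /\
  gamma k * dir_norm k * (dir_norm k + rx k + ry k) <= 2 * decrement k /\
  gamma k * (dir_norm k + rx k + ry k) ^ 2 <= 3 * decrement k.
Proof.
  unfold decrement. pose proof (gamma_range k) as Hg. set (g := gamma k) in *.
  set (d := dir_norm k). set (a := rx k). set (b := ry k).
  assert (Hle : forall s, 0 <= s -> g * s <= s) by (intros; nra).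
  pose proof (pow2_ge_0 a) as Ha. pose proof (pow2_ge_0 b) as Hb. pose proof (pow2_ge_0 d) as Hd.
  pose proof (Hle _ Ha). pose proof (Hle _ Hb).
  assert (0 <= g * d ^ 2) by nra.
  split; [lra|]. split; [|split].
  - replace ((g * d) ^ 2) with (g * (g * d ^ 2)) by ring. pose proof (Hle (g * d ^ 2)). lra.
  - assert (g * (2 * d * a) <= g * (d ^ 2 + a ^ 2)).
    { apply Rmult_le_compat_l; [lra|]. pose proof (pow2_ge_0 (d - a)). nra. }
    assert (g * (2 * d * b) <= g * (d ^ 2 + b ^ 2)).
    { apply Rmult_le_compat_l; [lra|]. pose proof (pow2_ge_0 (d - b)). nra. }
    lra.
  - assert (g * (d + a + b) ^ 2 <= g * (3 * (d ^ 2 + a ^ 2 + b ^ 2))).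
    { apply Rmult_le_compat_l; [lra|]. pose proof (pow2_ge_0 (d - a)).
      pose proof (pow2_ge_0 (d - b)). pose proof (pow2_ge_0 (a - b)). nra. }
    lra.
Qed.

Lemma merit_growth_nonneg : 0 <= merit_growth.
Proof.
  unfold merit_growth. pose proof merit_const_nonneg. pose proof step_const_nonneg. nra.
Qed.

Lemma avg_merit_step k : avg_merit (S k) <= avg_merit k + merit_growth * decrement k.
Proof.
  destruct (decrement_dominates k) as [Hw0 [Hw1 [Hw2 _]]].
  pose proof (Jmerit_xphi_step k) as H1. pose proof (Jmerit_xphi_bound k) as H2.
  pose proof merit_const_nonneg as Hm. pose proof step_const_nonneg as Hs.
  pose proof (gamma_dir_norm_nonneg k) as Hg. unfold avg_merit.
  set (j := Jmerit m n X G grad (xphi k)) in *. assert (0 <= j) by apply norm_nonneg.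
  set (e := gamma k * dir_norm k) in *.
  eapply Rle_trans; [apply pow_incr; split; [apply norm_nonneg|exact H1]|].
  assert (H3 : j * e <= merit_const * (2 * decrement k)).
  { eapply Rle_trans; [apply Rmult_le_compat_r; [exact Hg|exact H2]|].
    rewrite Rmult_assoc. apply Rmult_le_compat_l; [exact Hm|]. lra. }
  apply (Rmult_le_compat_l (2 * step_const)) in H3; [|lra].
  apply (Rmult_le_compat_l (step_const ^ 2)) in Hw1; [|apply pow2_ge_0].
  assert (0 <= merit_const ^ 2 * decrement k) by (apply Rmult_le_pos; [apply pow2_ge_0|exact Hw0]).
  unfold merit_growth. lra.
Qed.

Lemma gamma_avg_merit_bound k : gamma k * avg_merit k <= merit_growth * decrement k.
Proof.
  destruct (decrement_dominates k) as [Hw0 [_ [_ Hw3]]].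
  pose proof (Jmerit_xphi_bound k) as H2. pose proof (gamma_range k).
  pose proof merit_const_nonneg as Hm. pose proof step_const_nonneg as Hs. unfold avg_merit.
  assert (Hj : Jmerit m n X G grad (xphi k) ^ 2 <= (merit_const * (dir_norm k + rx k + ry k)) ^ 2)
    by (apply pow_incr; split; [apply norm_nonneg|exact H2]).
  apply (Rmult_le_compat_l (gamma k)) in Hj; [|lra].
  apply (Rmult_le_compat_l (merit_const ^ 2)) in Hw3; [|apply pow2_ge_0].
  assert (0 <= merit_const * step_const * decrement k) by (repeat apply Rmult_le_pos; assumption).
  assert (0 <= step_const ^ 2 * decrement k) by (apply Rmult_le_pos; [apply pow2_ge_0|exact Hw0]).
  unfold merit_growth. lra.
Qed.

Definition final_const : R :=
  2 * (step_const * (INR m * C)) ^ 2 + INR n * (INR m * C) ^ 2.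

(** J is moved from [xbar] to [xphi] by its Lipschitz bound, at a cost proportional to [rx k]; D is
    itself bounded by a multiple of [rx k]. [final_const] adds the two contributions to dominate the
    maximum. *)
Lemma Mmerit_bound k : 0 <= Mmerit m n X G grad x k <= 2 * avg_merit k + final_const * decrement k.
Proof.
  assert (Hrx : rx k ^ 2 <= decrement k).
  { unfold decrement. pose proof (gamma_range k). pose proof (pow2_ge_0 (dir_norm k)).
    pose proof (pow2_ge_0 (ry k)). nra. }
  pose proof (pow2_ge_0 (rx k)) as Hrx0.
  pose proof INR_n_ge_1 as Hn. pose proof (pow2_ge_0 (INR m * C)) as HmC.
  assert (Hq : 0 <= avg_merit k) by apply pow2_ge_0.
  set (s := (step_const * (INR m * C)) ^ 2).
  assert (Hs : 0 <= s) by apply pow2_ge_0.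
  assert (HJ : Jmerit m n X G grad (xbar n x k) ^ 2 <= 2 * avg_merit k + 2 * s * decrement k).
  { pose proof (Jmerit_lipschitz (xbar n x k) (xphi k) (xbar_feasible k)
      (proj1 (xphi_feasible_jensen k))) as H1. fold step_const in H1.
    pose proof (xbar_xphi_dist k) as H2.
    apply (Rmult_le_compat_l step_const) in H2; [|apply step_const_nonneg].
    unfold avg_merit. set (j := Jmerit m n X G grad (xphi k)) in *.
    set (b := step_const * (INR m * (C * rx k))) in *.
    apply Rle_trans with ((j + b) ^ 2).
    - apply pow_incr. split; [apply norm_nonneg|lra].
    - assert (b ^ 2 = s * rx k ^ 2) by (unfold b, s; ring).
      assert (s * rx k ^ 2 <= s * decrement k) by (apply Rmult_le_compat_l; assumption).
      pose proof (pow2_ge_0 (j - b)). nra. }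
  assert (HD : Dmerit m n x k ^ 2 <= INR n * (INR m * C) ^ 2 * decrement k).
  { unfold Dmerit. rewrite pow2_sqrt by (apply rsum_nonneg; intros; apply pow2_ge_0).
    rewrite Rmult_assoc, <- rsum_const. apply rsum_le; intros i Hi.
    apply Rle_trans with ((INR m * (C * rx k)) ^ 2).
    - apply pow_incr. split; [apply norm_nonneg|apply x_xbar_dist, Hi].
    - replace ((INR m * (C * rx k)) ^ 2) with ((INR m * C) ^ 2 * rx k ^ 2) by ring.
      apply Rmult_le_compat_l; assumption. }
  assert (Hw : 0 <= decrement k) by lra.
  assert (0 <= INR n * (INR m * C) ^ 2 * decrement k)
    by (apply Rmult_le_pos; [apply Rmult_le_pos; lra|exact Hw]).
  assert (0 <= 2 * s * decrement k) by (apply Rmult_le_pos; [lra|exact Hw]).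
  unfold final_const. fold s. unfold Mmerit. split.
  - eapply Rle_trans; [apply pow2_ge_0|apply Rmax_l].
  - apply Rmax_lub; lra.
Qed.

(** [alpha] and [gbar] enter with the conclusion of [lyapunov_decrease] as a premise, so that they
    can be chosen before the run. [K] is a time after which the step sizes lie below [gbar]. *)
Lemma run_converges alpha gbar K :
  0 <= alpha ->
  (forall g d a b u u', 0 < g <= gbar ->
     u' <= u - lb * tm / INR n * (g * d ^ 2) + tracking_const * (g * d) * (a + b)
           + INR n * Lm * (g * d) ^ 2 ->
     u' + alpha * (rho * a + g * d) ^ 2 + (rho * b + grad_drift_const * (a + g * d)) ^ 2
     <= u + alpha * a ^ 2 + b ^ 2
        - Rmin (lb * tm / INR n / 2) ((1 - rho) / 2) * (g * d ^ 2 + a ^ 2 + b ^ 2)) ->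
  (forall k, (K <= k)%nat -> gamma k <= gbar) ->
  cv_infty (fun N => sum_f_R0 gamma N) ->
  Un_cv (fun k => Mmerit m n X G grad x k) 0.
Proof.
  intros Halpha Hdec HK Hinf. pose proof INR_n_ge_1 as Hn.
  assert (Hc : 0 < Rmin (lb * tm / INR n / 2) ((1 - rho) / 2)).
  { apply Rmin_glb_lt; [|lra]. apply Rdiv_lt_0_compat; [|lra].
    apply Rdiv_lt_0_compat; [|lra]. apply Rmult_lt_0_compat; assumption. }
  destruct (merit_vanishes gamma decrement
    (fun k => potential k + alpha * rx k ^ 2 + ry k ^ 2) avg_merit
    (Rmin (lb * tm / INR n / 2) ((1 - rho) / 2)) merit_growth Vmin K) as [Hw Hq].
  - exact Hc.
  - exact merit_growth_nonneg.
  - intros k. apply decrement_dominates.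
  - intros k Hk. simpl rx. simpl ry. unfold decrement. apply Hdec; [|apply potential_descent].
    pose proof (gamma_range k). pose proof (HK k Hk). lra.
  - intros k. pose proof (potential_bounded_below k). pose proof (pow2_ge_0 (rx k)).
    pose proof (pow2_ge_0 (ry k)). nra.
  - intros k. apply pow2_ge_0.
  - exact avg_merit_step.
  - intros k. apply gamma_range.
  - exact gamma_avg_merit_bound.
  - exact Hinf.
  - apply cv_zero_of_le with (fun k => 2 * avg_merit k + final_const * decrement k).
    + exists 0%nat. intros k _. apply Mmerit_bound.
    + replace 0 with (2 * 0 + final_const * 0) by ring. apply CV_plus; apply cv_scal; assumption.
Qed.

End Run.
End Problem.

(** * Uniform constants over the agents and the two step-size regimes *)

Lemma lipschitz_on_weaken m X g L L' :
  L <= L' -> lipschitz_on m X g L -> lipschitz_on m X g L'.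
Proof.
  intros HL H x y Hx Hy. eapply Rle_trans; [apply H; assumption|].
  apply Rmult_le_compat_r; [apply norm_nonneg|exact HL].
Qed.

Lemma strongly_convex_on_weaken m X s tau tau' :
  tau' <= tau -> strongly_convex_on m X s tau -> strongly_convex_on m X s tau'.
Proof.
  intros Ht H x y t Hx Hy Hr. eapply Rle_trans; [apply H; assumption|].
  assert (0 <= t * (1 - t) * norm m (vsub x y) ^ 2)
    by (apply Rmult_le_pos; [nra|apply pow2_ge_0]).
  nra.
Qed.

Lemma constant_steps_diverge g : 0 < g -> cv_infty (fun N => sum_f_R0 (fun _ => g) N).
Proof.
  intros Hg M. destruct (INR_unbounded (M / g)) as [N HN]. exists N. intros k Hk.
  rewrite sum_cte. apply Rlt_le_trans with (g * INR N).
  - apply (Rmult_lt_compat_l g) in HN; [|exact Hg].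
    replace (g * (M / g)) with M in HN by (field; lra). lra.
  - apply Rmult_le_compat_l; [lra|]. apply le_INR. lia.
Qed.

Theorem mainTheorem14
  (m I : nat) (X O : vec -> Prop) (f : nat -> vec -> R) (grad : nat -> vec -> vec)
  (L : nat -> R) (G : vec -> R) (Ek : nat -> digraph) (A : nat -> nat -> nat -> R)
  (ft : nat -> vec -> vec -> R) (gft : nat -> vec -> vec -> vec) (tau Lt : nat -> R) :
  (0 < I)%nat ->
  (forall z, X z -> in_Vm m z) -> (exists z, X z) -> is_closed m X -> is_convex X ->
  (forall z, O z -> in_Vm m z) -> is_open m O -> (forall z, X z -> O z) ->
  (forall i, (i < I)%nat -> C1_on m O (f i) (grad i) /\ lipschitz_on m X (grad i) (L i)) ->
  convex_fun_on O G ->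
  (exists c, forall z, X z -> c <= rsum I (fun i => f i z) + G z) ->
  B_strongly_connected I Ek ->
  (exists kappa, 0 < kappa /\ forall k, compliant I Ek A kappa k) ->
  (forall k, col_stochastic I A k) ->
  (forall i, (i < I)%nat -> 0 < tau i /\
     forall z, X z ->
       strongly_convex_on m X (fun w => ft i w z) (tau i) /\
       C1_on m O (fun w => ft i w z) (fun w => gft i w z) /\
       gft i z z = grad i z /\
       lipschitz_on m X (fun w => gft i z w) (Lt i)) ->
  (* (a) diminishing step sizes *)
  (forall gamma : nat -> R,
     (forall k, 0 < gamma k <= 1) -> Un_cv gamma 0 ->
     cv_infty (fun n => sum_f_R0 gamma n) ->
     forall x xt xh phi y,
       sonata m I X G grad ft gamma A x xt xh phi y ->
       Un_cv (fun k => Mmerit m I X G grad x k) 0)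
  /\
  (* (b) constant step size below a threshold depending only on the data *)
  (exists gbar, 0 < gbar /\
     forall gam, 0 < gam <= gbar ->
     forall x xt xh phi y,
       sonata m I X G grad ft (fun _ => gam) A x xt xh phi y ->
       Un_cv (fun k => Mmerit m I X G grad x k) 0).
Proof.
  intros Hn HXV HXne HXcl HXcv HOV HOo HXO Hf HG [Vmin HV] HB HA HAs Hft.
  (* The bounds are on absolute values, so the common constants are positive whatever the signs of
     the given ones. *)
  destruct (exists_upper_bound I L) as [Lm [HLm HL]].
  destruct (exists_upper_bound I Lt) as [Ltm [HLtm HLt]].
  destruct (exists_positive_lower_bound I tau) as [tm [Htm Htau]]; [intros; apply Hft; assumption|].
  assert (Hgrad : forall i, (i < I)%nat -> has_gradient_on m O (f i) (grad i))
    by (intros i Hi; apply (proj1 (Hf i Hi))).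
  assert (Hlip : forall i, (i < I)%nat -> lipschitz_on m X (grad i) Lm).
  { intros i Hi. apply lipschitz_on_weaken with (L i); [|apply Hf, Hi].
    eapply Rle_trans; [apply Rle_abs|apply HL, Hi]. }
  assert (Hsc : forall i z, (i < I)%nat -> X z -> strongly_convex_on m X (fun w => ft i w z) tm).
  { intros i z Hi Hz. apply strongly_convex_on_weaken with (tau i); [apply Htau, Hi|].
    now apply (proj2 (Hft i Hi) z Hz). }
  assert (Hsg : forall i z, (i < I)%nat -> X z ->
    has_gradient_on m O (fun w => ft i w z) (fun w => gft i w z)).
  { intros i z Hi Hz. now destruct (proj2 (Hft i Hi) z Hz) as [_ [[? _] _]]. }
  assert (Hcons : forall i z, (i < I)%nat -> X z -> gft i z z = grad i z).
  { intros i z Hi Hz. now destruct (proj2 (Hft i Hi) z Hz) as [_ [_ [? _]]]. }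
  assert (Hsl : forall i z, (i < I)%nat -> X z -> lipschitz_on m X (fun w => gft i z w) Ltm).
  { intros i z Hi Hz. apply lipschitz_on_weaken with (Lt i);
      [eapply Rle_trans; [apply Rle_abs|apply HLt, Hi]|].
    now destruct (proj2 (Hft i Hi) z Hz) as [_ [_ [_ ?]]]. }
  destruct (perturbed_consensus I Ek A Hn HB HA HAs)
    as [rho [C [lb [Hrho [HC [Hlb Hconsensus]]]]]].
  assert (HIR : 1 <= INR I) by (change 1 with (INR 1); apply le_INR; lia).
  (* Every argument is built from the problem data and the network, hence a single [gbar] serves all
     runs. *)
  destruct (lyapunov_decrease (lb * tm / INR I) (grad_drift_const m Lm C lb)
              (tracking_const m I Lm C) (INR I * Lm) rho) as [alpha [gbar [Halpha [Hgbar Hdec]]]].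
  { apply Rdiv_lt_0_compat; [apply Rmult_lt_0_compat; assumption|lra]. }
  { apply Rmult_le_pos; lra. }
  { exact Hrho. }
  assert (Hmain : forall gamma : nat -> R, (forall k, 0 < gamma k <= 1) ->
    (exists K, forall k, (K <= k)%nat -> gamma k <= gbar) ->
    cv_infty (fun N => sum_f_R0 gamma N) ->
    forall x xt xh phi y, sonata m I X G grad ft gamma A x xt xh phi y ->
    Un_cv (fun k => Mmerit m I X G grad x k) 0).
  { intros gamma Hgam [K HK] Hinf x xt xh phi y Hrun.
    destruct (Hconsensus phi) as [Hphi Hcs].
    { intros i Hi. apply (proj1 Hrun i Hi). }
    { intros k i Hi. apply (proj2 Hrun k i Hi). }
    apply (run_converges m I X O f grad G A ft gft Lm Ltm tm Vmin) with
      (rho := rho) (C := C) (lb := lb) (gamma := gamma) (xt := xt) (xh := xh) (phi := phi)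
      (y := y) (alpha := alpha) (gbar := gbar) (K := K); auto; lra. }
  split.
  - intros gamma Hgam Hcv Hinf. apply Hmain; [exact Hgam| |exact Hinf].
    destruct (Hcv gbar Hgbar) as [K HK]. exists K. intros k Hk. specialize (HK k Hk).
    unfold Rdist in HK. rewrite Rminus_0_r in HK. apply Rabs_def2 in HK. lra.
  (* The cap at 1 keeps [xh] a convex combination of [x] and [xt]. *)
  - exists (Rmin gbar 1). split; [apply Rmin_glb_lt; lra|]. intros gam Hgam.
    pose proof (Rmin_l gbar 1). pose proof (Rmin_r gbar 1). apply Hmain.
    + intros _. lra.
    + exists 0%nat. intros _ _. lra.
    + apply constant_steps_diverge. lra.
Qed.
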